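(* Let $(G,\Sigma_G,\pi)$ be a probability space such that for every $N\in\mathbb N$ there are pairwise disjoint measurable sets $G_{1,N},\dots,G_{N,N}\subset G$ with $\bigcup_{j=1}^NG_{j,N}=G$ and $\pi(G_{j,N})=1/N$ for all $j=1,\dots,N$. Let $1\le p<q\le\infty$, $K>1$ and $\tau>0$. Consider the integration problem of computing $\mathrm{INT}(f)=\int_Gf\,d\pi$ by general randomized algorithms. 1. The integration problem is not solvable on $\mathcal F=L_q(\pi)$. 2. For any general randomized algorithm $Q$ on $\mathcal F_{p,q,K}(\pi)$, $$\sup_{f\in\mathcal F_{p,q,K}(\pi)}\mathbb E|Q(f)-\mathrm{INT}(f)|=\infty.$$ 3. For any $\varepsilon>0$ and $\delta\in(0,1)$, $$\bar n^{\mathrm{fix}}(\varepsilon,\delta,\mathcal F_{p,q,K}(\pi))\ge\frac1{2\log2}\,K^{pq/(q-p)}\log\delta^{-1}.$$ 4. With $\tilde q:=\min\{q,2\}$ there is a constant $c_{q,K}>0$ depending only on $q$ and $K$ such that $$\bar n^{\mathrm{wor}}(\varepsilon,\delta,\mathcal F_{p,q,K}(\pi)\cap\tau\mathcal B_{\tilde q})\ge c_{q,K}\left(\frac\tau\varepsilon\right)^{1+1/(\tilde q-1)}\log\left(\tfrac43\delta\right)^{-1}$$ for any $0<\varepsilon<\frac16(1-1/K)\,\tau$ and $0<\delta<1/4$, where $\log\left(\tfrac43\delta\right)^{-1}$ denotes $\log\left(1/(\tfrac43\delta)\right)$.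
   Context: $\|f\|_q$ denotes the $L_q(\pi)$-norm of a measurable function $f:G\to\mathbb R$. For $q=\infty$, $pq/(q-p)$ is read as $p$. Put $$\mathcal F_{p,q,K}(\pi):=\{f\in L_q(\pi)\mid\|f-\mathrm{INT}(f)\|_q\le K\|f-\mathrm{INT}(f)\|_p\},\quad \tau\mathcal B_{\tilde q}:=\{f\in L_{\tilde q}(\pi)\mid\|f-\mathrm{INT}(f)\|_{\tilde q}\le\tau\}.$$ Functions in these classes are genuine functions $f:G\to\mathbb R$ that can be evaluated at points. A general randomized algorithm $Q$ on a class $\mathcal F$ of measurable functions $G\to\mathbb R$ lives on a probability space $(\Omega,\Sigma,\mathbb P)$ and consists of: a random variable $U$ with values in a measurable space $(\mathbb U,\Sigma_U)$; a measurable output function $\phi:\mathbb U\times\mathbb R^{\mathbb N}\to\mathbb R$; a measurable stopping rule $n:\mathbb U\times\mathbb R^{\mathbb N}\to\mathbb N_0\cup\{\infty\}$ such that whether $n(u,(y_j)_j)\ge i$ depends only on $(u,y_1,\dots,y_{i-1})$; and measurable sampling nodes $\mathbf X_i:\Omega\times\mathbb R^{i-1}\to G$, $i\in\mathbb N$. For $f\in\mathcal F$ the information $N(\omega,f)=(y_i)_{i\in\mathbb N}$ is given (recursively) by $y_i=f(\mathbf X_i(\omega,y_1,\dots,y_{i-1}))$ if $n(U(\omega),(y_j)_j)\ge i$ and $y_i=0$ otherwise; the information map is assumed measurable. The output is $Q(\omega,f):=\phi(U(\omega),N(\omega,f))$, $Q(f):=Q(\cdot,f)$, and the cost $n(\omega,f):=n(U(\omega),N(\omega,f))$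 is assumed almost surely finite for every $f\in\mathcal F$. $Q$ is $(\varepsilon,\delta)$-approximating on $\mathcal F$ if $\mathbb P\{|Q(f)-\mathrm{INT}(f)|\le\varepsilon\}\ge1-\delta$ for all $f\in\mathcal F$. The integration problem is solvable on $\mathcal F$ if for all $\varepsilon>0$ and $\delta\in(0,1)$ there is a general randomized algorithm that is $(\varepsilon,\delta)$-approximating on $\mathcal F$. With $\bar n(Q,f):=\mathbb E\,n(\cdot,f)$, put $\bar n^{\mathrm{fix}}(Q,\mathcal F):=\inf_{f\in\mathcal F}\bar n(Q,f)$, $\bar n^{\mathrm{wor}}(Q,\mathcal F):=\sup_{f\in\mathcal F}\bar n(Q,f)$, and for $\ast\in\{\mathrm{fix},\mathrm{wor}\}$ $$\bar n^{\ast}(\varepsilon,\delta,\mathcal F):=\inf\{n>0\mid\exists\ (\varepsilon,\delta)\text{-approximating general randomized } Q\text{ on }\mathcal F\text{ with }\bar n^{\ast}(Q,\mathcal F)\le n\}.$$ *)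

(* Defs.v *)
From HB Require Import structures.
From mathcomp Require Import all_boot all_order all_algebra.
From mathcomp Require Import all_classical all_reals all_analysis.

Set Implicit Arguments.
Unset Strict Implicit.
Unset Printing Implicit Defensive.

Import Order.TTheory GRing.Theory Num.Theory.

Local Open Scope classical_set_scope.
Local Open Scope ring_scope.

(* R^N with the product (cylinder) sigma-algebra. *)
Definition rawseq (R : realType) : Type := nat -> R.
HB.instance Definition _ (R : realType) := Choice.on (rawseq R).
HB.instance Definition _ (R : realType) := isPointed.Build (rawseq R) (fun=> 0).
Definition coordinate_cylinders (R : realType) : set_system (rawseq R) :=
  \bigcup_(i in [set: nat])
    preimage_set_system setT (fun y : rawseq R => y i) (@measurable _ R).
Notation realseq R := (g_sigma_algebraType (@coordinate_cylinders R)).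

(* Values in {0, 1, 2, ...} with infinity: [None] stands for infinity. *)
Definition enat_ge (m : option nat) (i : nat) : bool :=
  if m is Some k then (i <= k)%N else true.

Definition enat_ereal (R : realType) (m : option nat) : \bar R :=
  if m is Some k then k%:R%:E else +oo%E.

Definition prefix_tuple (R : realType) (y : nat -> R) (i : nat) : i.-tuple R :=
  [tuple y j | j < i].

(* Indices are shifted by one: [node i] is the (i+1)-st sampling node, which
   depends on i previously observed values, and [y i] is the (i+1)-st
   observation. *)
Record randomized_algorithm (R : realType) (d : measure_display)
    (G : measurableType d) := RandomizedAlgorithm {
  display_Omega : measure_display;
  Omega : measurableType display_Omega;
  Prob : probability Omega R;
  display_seed : measure_display;
  seed_space : measurableType display_seed;
  seed : {RV Prob >-> seed_space};
  output : {mfun (seed_space * realseq R)%type >-> R};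
  stop : seed_space * realseq R -> option nat;
  measurable_stop : forall A : set (option nat), measurable (stop @^-1` A);
  stop_nonanticipating : forall (i : nat) (u : seed_space) (y z : realseq R),
    (forall j, (j < i)%N -> y j = z j) ->
    enat_ge (stop (u, y)) i.+1 = enat_ge (stop (u, z)) i.+1;
  node : forall i : nat, {mfun (Omega * i.-tuple R)%type >-> G} }.

Section run.
Context (R : realType) (d : measure_display) (G : measurableType d).
Variables (Q : randomized_algorithm R G) (f : G -> R) (w : Omega Q).

(* The first k observations, padded with zeros. *)
Fixpoint observations (k : nat) : realseq R :=
  if k is i.+1 then
    let y := observations i in
    fun j => if j == i then
        if enat_ge (stop (seed Q w, y)) i.+1
        then f (node Q i (w, prefix_tuple y i)) else 0
      else y j
  else fun=> 0.

Definition information : realseq R := fun i => observations i.+1 i.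

Lemma observationsE k j :
  observations k j = if (j < k)%N then information j else 0.
Proof.
elim: k => [|k IH] //=; rewrite ltnS.
have [->|jk] := eqVneq j k; first by rewrite leqnn /information /= eqxx.
by rewrite IH [in RHS]leq_eqVlt (negbTE jk).
Qed.

(* The defining recursion of the information. *)
Lemma informationE i : information i =
  if enat_ge (stop (seed Q w, information)) i.+1
  then f (node Q i (w, prefix_tuple information i)) else 0.
Proof.
have obs j : (j < i)%N -> observations i j = information j.
  by move=> ji; rewrite observationsE ji.
rewrite {1}/information /= eqxx (stop_nonanticipating _ obs).
congr (if _ then f (node _ _ (_, _)) else _).
by apply: eq_from_tnth => j; rewrite !tnth_mktuple obs.
Qed.

Definition result : R := output Q (seed Q w, information).

Definition cost : option nat := stop (seed Q w, information).

End run.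

Arguments observations {R d G} Q f w k.
Arguments information {R d G} Q f w.
Arguments result {R d G} Q f w.
Arguments cost {R d G} Q f w.

Section integration_problem.
Context (R : realType) (d : measure_display) (G : measurableType d).
Variable pi : probability G R.

Definition INT (f : G -> R) : R := \int[pi]_x f x.

Definition algorithm_on (Q : randomized_algorithm R G) (F : set (G -> R)) :=
  forall f, F f ->
    measurable_fun setT (information Q f) /\
    {ae Prob Q, forall w, cost Q f w <> None}.

Definition approximating (Q : randomized_algorithm R G) (eps delta : R)
    (F : set (G -> R)) :=
  forall f, F f ->
    ((1 - delta)%:E <=
       Prob Q [set w | `|result Q f w - INT f| <= eps]%R)%E.

Definition solvable (F : set (G -> R)) :=
  forall eps delta : R, 0 < eps -> 0 < delta < 1 ->
    exists Q : randomized_algorithm R G,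
      algorithm_on Q F /\ approximating Q eps delta F.

Definition mean_cost (Q : randomized_algorithm R G) (f : G -> R) : \bar R :=
  (\int[Prob Q]_w enat_ereal R (cost Q f w))%E.

Definition cost_fix (Q : randomized_algorithm R G) (F : set (G -> R)) : \bar R :=
  ereal_inf [set mean_cost Q f | f in F].

Definition cost_wor (Q : randomized_algorithm R G) (F : set (G -> R)) : \bar R :=
  ereal_sup [set mean_cost Q f | f in F].

Definition complexity
    (cost_of : randomized_algorithm R G -> set (G -> R) -> \bar R)
    (eps delta : R) (F : set (G -> R)) : \bar R :=
  ereal_inf [set n%:E | n in [set n : R | 0 < n /\
    exists Q : randomized_algorithm R G,
      [/\ algorithm_on Q F, approximating Q eps delta F &
          (cost_of Q F <= n%:E)%E]]].

Definition complexity_fix := complexity cost_fix.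
Definition complexity_wor := complexity cost_wor.

Definition Lclass (q : \bar R) : set (G -> R) := [set f | f \in Lfun pi q].

Definition centered_norm (q : \bar R) (f : G -> R) : \bar R :=
  ('N[pi]_q[EFin \o (f \- cst (INT f))%R])%E.

Definition cone_class (p q : \bar R) (K : R) : set (G -> R) :=
  [set f | Lclass q f /\
    (centered_norm q f <= K%:E * centered_norm p f)%E].

Definition ball_class (q : \bar R) (tau : R) : set (G -> R) :=
  [set f | Lclass q f /\ (centered_norm q f <= tau%:E)%E].

Definition equipartitionable := forall N : nat, (0 < N)%N ->
  exists A : 'I_N -> set G,
    [/\ forall j, measurable (A j), trivIset setT A,
        \bigcup_j A j = setT & forall j, pi (A j) = (N%:R^-1)%:E].

End integration_problem.

(* pq/(q-p), read as p when q is infinite; -oo is a junk case. *)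
Definition cone_exponent (R : realType) (p : R) (q : \bar R) : R :=
  match q with
  | q'%:E => p * q' / (q' - p)
  | +oo%E => p
  | -oo%E => 0
  end.

Definition min2 (R : realType) (q : \bar R) : \bar R := Order.min q 2%:E.

(* Main.v *)
(* A run of an algorithm on f is unchanged if f is modified off the nodes that
   it visits. Let A be a random set of measure about t, a union of many small
   cells chosen independently: a run of cost n misses A with probability at
   least (1-t)^n, so by Jensen E n >= log(1/rho) / log(1/(1-t)) as soon as
   every such A is missed with probability at most rho. In L_q arbitrary bumps
   c 1_A may be added to f = 0, so rho = delta for arbitrarily small t, which
   contradicts a.s. finite cost. In the cone, bumps with t > K^(-pq/(q-p)) and
   all large c are allowed, since the q- and p-norms of 1_A - t have ratio at
   most t^(1/q - 1/p) for t <= 1/2. For the worst-case cost and q <= 2, a bump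
   of integral 3 eps is added to a balanced sign function, which keeps the sum
   inside the cone; the norm bound allows t of order (eps/tau)^(q/(q-1)), at
   the price rho = 2 delta. For q > 2 the bump is replaced by independent
   signs on the cells with bias +th or -th, th of order eps/tau. Deciding the
   sign of the bias from adaptively chosen cells costs relative entropy: by
   Wald's identity the observed log-likelihood ratio has mean
   log((1+th)/(1-th)) th E n, which must be at least (1-2 delta)
   log((1-delta)/delta). *)

Require Import Defs.
From HB Require Import structures.
From mathcomp Require Import all_boot all_order all_algebra.
From mathcomp Require Import all_classical all_reals all_analysis.
From mathcomp Require Import measurable_realfun ess_sup_inf.
From mathcomp Require Import ring lra.

Set Implicit Arguments.
Unset Strict Implicit.
Unset Printing Implicit Defensive.

Import Order.TTheory GRing.Theory Num.Theory.

Local Open Scope classical_set_scope.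
Local Open Scope ring_scope.

(** * Product Bernoulli weights on finite configurations *)

(** Only finite randomness is used: one bit per cell of a single equipartition, with the point omega
    of the algorithm held fixed. Averages over random sets are then finite sums, and the
    combinatorial inequalities hold for each omega before they are integrated. The price is that the
    random set has measure only close to t. Bumps must therefore be admissible in a window of radius
    eta about t; configurations outside the window have weight at most 1/(n eta^2) for n cells, and
    this error vanishes as n grows, since no other term depends on n. Constants: 1/(2 log 2) is the
    slope of a chord of log(1/(1-t)) on [0, 1/2]. In the worst-case bound, tau is shared between a
    function of constant modulus and a perturbation of norm at most (1 - 1/K) tau / 2, which leaves
    a q-norm at most tau and a p-norm at least tau/K; the condition on eps says that this share
    exceeds 3 eps. The form 4/3 delta serves both methods: its inverse is at most (1 - delta)/delta
    when delta <= 1/4, and at most (2 delta)^(-2) when delta <= 1/3. *)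

Section bernoulli_weights.
Context (R : realType) (T : finType).
Implicit Types (t : R) (s : {ffun T -> bool}).

Definition bern t (b : bool) : R := if b then t else 1 - t.

Definition bernw t s : R := \prod_j bern t (s j).

Lemma bern_ge0 t b : 0 <= t <= 1 -> 0 <= bern t b.
Proof. by case/andP => t0 t1; case: b => //=; rewrite subr_ge0. Qed.

Lemma bern_gt0 t b : 0 < t < 1 -> 0 < bern t b.
Proof. by case/andP => t0 t1; case: b => //=; rewrite subr_gt0. Qed.

Lemma bernw_ge0 t s : 0 <= t <= 1 -> 0 <= bernw t s.
Proof. by move=> t01; apply: prodr_ge0 => j _; exact: bern_ge0. Qed.

Lemma sum_ffun_prod (F : T -> bool -> R) :
  \sum_(s : {ffun T -> bool}) \prod_j F j (s j) =
  \prod_j (F j true + F j false).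
Proof.
by rewrite -bigA_distr_bigA; apply: eq_bigr => j _; rewrite big_bool.
Qed.

Lemma sum_bernw t : \sum_s bernw t s = 1.
Proof.
by rewrite (sum_ffun_prod (fun=> bern t)) big1// => j _ /=; rewrite subrKC.
Qed.

(** The indicator of avoiding [S] is itself a product over coordinates, so the sum factorises: a
    coordinate in [S] contributes 1 - t and any other contributes 1. *)
Lemma sum_bernw_avoid t (S : {set T}) :
  \sum_(s : {ffun T -> bool} | [forall j in S, ~~ s j]) bernw t s =
  (1 - t) ^+ #|S|.
Proof.
rewrite big_mkcond/=.
pose F j b := bern t b * ((j \in S) ==> ~~ b)%:R.
rewrite (eq_bigr (fun s : {ffun T -> bool} => \prod_j F j (s j))); last first.
  move=> s _; rewrite big_split/= -/(bernw t s).
  have -> : \prod_i ((i \in S) ==> ~~ s i)%:R =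
      [forall j in S, ~~ s j]%:R :> R.
    case: forallP => [h|/forallP/forallPn[j hj]].
      by rewrite big1// => j _; rewrite h.
    by rewrite (bigD1 j)//= (negbTE hj) mul0r.
  by case: ifP; rewrite ?mulr1 ?mulr0.
rewrite (sum_ffun_prod F) (bigID (mem S))/= [X in _ * X]big1 ?mulr1; last first.
  by move=> j /negbTE jS; rewrite /F jS/= !mulr1 subrKC.
rewrite (eq_bigr (fun=> 1 - t)) ?prodr_const// => j jS.
by rewrite /F jS/= mulr0 mulr1 add0r.
Qed.

Definition flip (j : T) s : {ffun T -> bool} := [ffun i => (i == j) (+) s i].

Lemma flipK j : involutive (flip j).
Proof. by move=> s; apply/ffunP => i; rewrite !ffunE addKb. Qed.

(* Averaging the sum with its image under the flip of [s j] decouples [s j]. *)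
Lemma sum_bernw_indep t j (F : {ffun T -> bool} -> R) (y : bool -> R) :
  (forall s, F (flip j s) = F s) ->
  \sum_s bernw t s * (F s * y (s j)) =
  (t * y true + (1 - t) * y false) * \sum_s bernw t s * F s.
Proof.
move=> Fj; pose r s := \prod_(i | i != j) bern t (s i).
have wE s : bernw t s = bern t (s j) * r s by rewrite /bernw (bigD1 j).
have rj s : r (flip j s) = r s.
  by apply: eq_bigr => i /negbTE ij; rewrite ffunE ij.
have sj s : flip j s j = ~~ s j by rewrite ffunE eqxx addTb.
have symm (z : bool -> R) : \sum_s bernw t s * (F s * z (s j)) =
    2^-1 * ((t * z true + (1 - t) * z false) * \sum_s r s * F s).
  apply: (@mulfI _ 2); first by rewrite pnatr_eq0.
  rewrite mulVKf ?pnatr_eq0// mulr2n mulrDl mul1r.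
  rewrite [in X in _ + X](reindex_inj (can_inj (flipK j)))/= -big_split/=.
  rewrite mulr_sumr; apply: eq_bigr => s _.
  by rewrite Fj !wE rj sj; case: (s j) => /=; ring.
rewrite symm; have := symm (fun=> 1).
under eq_bigr do rewrite mulr1.
by move=> ->; field.
Qed.

Definition freq s : R := (\sum_j (s j)%:R) / #|T|%:R.

(** Distinct coordinates are uncorrelated by [sum_bernw_indep], so only the diagonal of the squared
    sum survives. *)
Lemma freq_variance t : (0 < #|T|)%N ->
  \sum_s bernw t s * (freq s - t) ^+ 2 = t * (1 - t) / #|T|%:R.
Proof.
move=> T0; have n0 : #|T|%:R != 0 :> R by rewrite pnatr_eq0 -lt0n.
pose y (b : bool) : R := b%:R - t.
have freqE s : freq s - t = (\sum_j y (s j)) / #|T|%:R.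
  by rewrite /freq /y sumrB sumr_const -[t *+ _]mulr_natr; field.
under eq_bigr do rewrite freqE exprMn mulrA.
rewrite -mulr_suml.
suff -> : \sum_s bernw t s * (\sum_j y (s j)) ^+ 2 = t * (1 - t) *+ #|T|.
  by rewrite -[_ *+ _]mulr_natr; field.
under eq_bigr do rewrite expr2 mulr_suml mulr_sumr.
rewrite exchange_big/= -sumr_const; apply: eq_bigr => i _.
under eq_bigr do rewrite !mulr_sumr.
rewrite exchange_big/= (bigD1 i)//= [X in _ + X]big1 ?addr0; last first.
  move=> j ji; rewrite (@sum_bernw_indep t j (fun s => y (s i)) y) /y /=.
    by rewrite [X in X * _](_ : _ = 0) ?mul0r//; ring.
  by move=> s; rewrite ffunE eq_sym (negbTE ji).
have /= := @sum_bernw_indep t i (fun=> 1) (fun b => y b * y b) (fun=> erefl).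
under eq_bigr do rewrite mul1r.
under [in X in _ = X -> _]eq_bigr do rewrite mulr1.
by rewrite sum_bernw => ->; rewrite /y /=; ring.
Qed.

(** Chebyshev's inequality, with t (1 - t) bounded by 1: only the decay in the number of coordinates
    matters. *)
Lemma freq_concentration t (eta : R) : 0 <= t <= 1 -> 0 < eta -> (0 < #|T|)%N ->
  \sum_(s | eta <= `|freq s - t|) bernw t s <= (#|T|%:R * eta ^+ 2)^-1.
Proof.
move=> t01 eta0 T0.
have n0 : 0 < #|T|%:R :> R by rewrite ltr0n.
apply: (@le_trans _ _ (\sum_s bernw t s * (freq s - t) ^+ 2 / eta ^+ 2)).
  rewrite big_mkcond/=; apply: ler_sum => s _.
  have w0 := bernw_ge0 s t01; case: ifPn => [h|_]; last first.
    exact: divr_ge0 (mulr_ge0 w0 (sqr_ge0 _)) (sqr_ge0 _).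
  rewrite -mulrA ler_peMr// ler_pdivlMr ?exprn_gt0// mul1r.
  by rewrite -[leRHS]real_normK ?num_real// lerXn2r// ?nnegrE// ltW.
rewrite -mulr_suml freq_variance// [leRHS]invfM ler_pM2r ?invr_gt0 ?exprn_gt0//.
by rewrite -[leRHS]mul1r ler_pM2r ?invr_gt0//; nra.
Qed.

(* The set of coordinates inspected by an adaptive procedure is determined by
   the values found on it. *)
Definition self_determined (V : {ffun T -> bool} -> {set T}) :=
  forall s s', (forall j, j \in V s -> s' j = s j) -> V s' = V s.

(** If [j] is not inspected, flipping its bit leaves every inspected bit intact, hence also the
    inspected set. Thus whether [j] is inspected is independent of the bit at [j]. *)
Lemma self_determined_flip V j s :
  self_determined V -> (j \in V (flip j s)) = (j \in V s).
Proof.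
move=> Vd; have half s1 : j \notin V s1 -> V (flip j s1) = V s1.
  move=> jV; apply: Vd => i iV; rewrite ffunE.
  by case: eqP iV jV => [-> ->//|].
have [jV|jV] := boolP (j \in V s); last by rewrite half// (negbTE jV).
apply/negPn/negP => jV'; have := half _ jV'; rewrite flipK => VE.
by rewrite VE (negbTE jV') in jV.
Qed.

(** The sum is split over coordinates: inspection of [j] is unaffected by flipping [s j], so each
    term decouples into the mean of [y] times the probability of inspection. *)
Lemma wald_identity V t (y : bool -> R) : self_determined V ->
  \sum_s bernw t s * \sum_(j in V s) y (s j) =
  (t * y true + (1 - t) * y false) * \sum_s bernw t s * #|V s|%:R.
Proof.
move=> Vd.
have -> : \sum_s bernw t s * #|V s|%:R =
    \sum_s \sum_j bernw t s * (j \in V s)%:R.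
  apply: eq_bigr => s _; rewrite -sum1_card natr_sum mulr_sumr big_mkcond/=.
  by apply: eq_bigr => j _; case: (j \in V s); rewrite /= ?mulr0.
rewrite [in RHS]exchange_big mulr_sumr/=.
transitivity (\sum_s \sum_j bernw t s * ((j \in V s)%:R * y (s j))).
  apply: eq_bigr => s _; rewrite mulr_sumr big_mkcond/=.
  by apply: eq_bigr => j _; case: (j \in V s); rewrite ?mul1r ?mul0r ?mulr0.
rewrite exchange_big/=; apply: eq_bigr => j _.
rewrite (@sum_bernw_indep t j (fun s => (j \in V s)%:R))// => s.
by rewrite self_determined_flip.
Qed.

(* The splice swaps two configurations on the coordinates inspected by the
   first one. *)
Lemma likelihood_identity V t t' (A : {ffun T -> bool} -> bool) :
  0 < t < 1 -> self_determined V ->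
  (forall s s', (forall j, j \in V s -> s' j = s j) -> A s' = A s) ->
  \sum_(s | A s) bernw t s * \prod_(j in V s) (bern t' (s j) / bern t (s j)) =
  \sum_(s | A s) bernw t' s.
Proof.
move=> t01 Vd Ad.
pose splice (V0 : {set T}) s s' : {ffun T -> bool} :=
  [ffun j => if j \in V0 then s j else s' j].
have spliceT (V0 : {set T}) r s s' :
    \prod_(j in V0) bern r (splice V0 s s' j) = \prod_(j in V0) bern r (s j).
  by apply: eq_bigr => j jV; rewrite ffunE jV.
have spliceF (V0 : {set T}) r s s' :
    \prod_(j | j \notin V0) bern r (splice V0 s s' j) =
    \prod_(j | j \notin V0) bern r (s' j).
  by apply: eq_bigr => j /negbTE jV; rewrite ffunE jV.
pose Phi (u : {ffun T -> bool} * {ffun T -> bool}) :=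
  (splice (V u.1) u.1 u.2, splice (V u.1) u.2 u.1).
have VPhi u : V (Phi u).1 = V u.1.
  by apply: Vd => j jV; rewrite ffunE jV.
have APhi u : A (Phi u).1 = A u.1.
  by apply: Ad => j jV; rewrite ffunE jV.
have PhiK : involutive Phi.
  move=> [s s']; rewrite {1}/Phi VPhi /Phi/=.
  by congr pair; apply/ffunP => j; rewrite !ffunE; case: (j \in V s).
(* The law with bias [t'] on [V0] and [t] elsewhere; reweighting [bernw t] by the likelihood ratio
   gives [mix (V s) s]. *)
pose mix (V0 : {set T}) s := \prod_(j in V0) bern t' (s j) *
  \prod_(j | j \notin V0) bern t (s j).
have sum_mix V0 : \sum_s mix V0 s = 1.
  have mixE s : mix V0 s = \prod_j (if j \in V0 then bern t' else bern t) (s j).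
    rewrite (bigID (mem V0))/=; congr (_ * _); apply: eq_bigr => j.
      by move=> ->.
    by move=> /negbTE ->.
  rewrite (eq_bigr _ (fun s _ => mixE s)).
  rewrite (sum_ffun_prod (fun j => if j \in V0 then bern t' else bern t)).
  by rewrite big1// => j _; case: ifP => _ /=; rewrite subrKC.
have reweight s : bernw t s * \prod_(j in V s) (bern t' (s j) / bern t (s j)) =
    mix (V s) s.
  rewrite /bernw (bigID (mem (V s)))/= mulrAC -big_split/=; congr (_ * _).
  by apply: eq_bigr => j _; rewrite mulrC divfK// gt_eqF// bern_gt0.
under eq_bigr do rewrite reweight.
(* An independent second configuration of total mass 1 is introduced. The swap regroups the factors
   into [bernw t'] of the first and a mixed law of the second, whose total mass is again 1. *)
transitivity (\sum_(u | A u.1 && predT u.2) mix (V u.1) u.1 * bernw t' u.2).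
  rewrite -(pair_big A predT (fun s s' => mix (V s) s * bernw t' s'))/=.
  by apply: eq_bigr => s _; rewrite -mulr_sumr sum_bernw mulr1.
transitivity (\sum_(u | A u.1 && predT u.2) bernw t' u.1 * mix (V u.1) u.2);
  last first.
  rewrite -(pair_big A predT (fun s s' => bernw t' s * mix (V s) s'))/=.
  by apply: eq_bigr => s _; rewrite -mulr_sumr sum_mix mulr1.
rewrite (reindex_inj (can_inj PhiK))/=.
apply: eq_big => [u|[s s'] _]; first by rewrite APhi.
rewrite VPhi /mix /bernw /Phi/= !(bigID (mem (V s)) predT)/=.
by rewrite !spliceT !spliceF; ring.
Qed.

End bernoulli_weights.

(** * Relative entropy and testing between two biases *)

Section testing.
Context (R : realType) (T : finType).
Implicit Types (s : {ffun T -> bool}).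

(** The log-likelihood ratio of a true bit between the biases (1 + th)/2 and (1 - th)/2; a false bit
    contributes the opposite value. *)
Definition log_odds (th : R) : R := ln ((1 + th) / (1 - th)).

Lemma expR_log_odds (th : R) : 0 < th < 1 ->
  expR (log_odds th) = (1 + th) / (1 - th).
Proof.
case/andP => th0 th1; rewrite lnK// posrE divr_gt0 ?subr_gt0//.
by rewrite addr_gt0.
Qed.

(* This is the data-processing inequality for the relative entropy of the two
   observation laws, linearised by [exp (l - z) >= 1 + l - z] so that it stays
   true after averaging over a randomised procedure. *)
Lemma testing_inequality (V : {ffun T -> bool} -> {set T})
    (A : {ffun T -> bool} -> bool) (th l : R) : 0 < th < 1 -> 
  self_determined V ->
  (forall s s', (forall j, j \in V s -> s' j = s j) -> A s' = A s) ->
  1 + l - expR (- l) <=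
    log_odds th * th * \sum_s bernw ((1 + th) / 2) s * #|V s|%:R
    + 2 * l * \sum_(s | ~~ A s) bernw ((1 + th) / 2) s
    + (expR l - expR (- l)) * \sum_(s | A s) bernw ((1 - th) / 2) s.
Proof.
move=> th01 Vd Ad; have /andP[th0 th1] := th01.
set t := (1 + th) / 2; set t' := (1 - th) / 2.
have t01 : 0 < t < 1 by rewrite /t; apply/andP; split; lra.
pose x (b : bool) : R := if b then log_odds th else - log_odds th.
pose L s := \sum_(j in V s) x (s j).
have odds0 : (1 - th) / (1 + th) = expR (- log_odds th).
  by rewrite expRN expR_log_odds// invf_div.
have ratioE s : \prod_(j in V s) (bern t' (s j) / bern t (s j)) = expR (- L s).
  rewrite /L -sumrN expR_sum; apply: eq_bigr => j _; rewrite /x /t /t'.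
  case: (s j) => /=.
    by rewrite -odds0; field; lra.
  by rewrite opprK expR_log_odds//; field; lra.
have lik (B : {ffun T -> bool} -> bool) :
    (forall s s', (forall j, j \in V s -> s' j = s j) -> B s' = B s) ->
    \sum_(s | B s) bernw t s * expR (- L s) = \sum_(s | B s) bernw t' s.
  move=> Bd; rewrite -(likelihood_identity t' t01 Vd Bd).
  by apply: eq_bigr => s _; rewrite ratioE.
have likA := lik A Ad.
have likAC : \sum_(s | ~~ A s) bernw t s * expR (- L s) =
    \sum_(s | ~~ A s) bernw t' s.
  by apply: (lik (fun s => ~~ A s)) => s s' ss'; rewrite (Ad s s').
have waldE : log_odds th * th * \sum_s bernw t s * #|V s|%:R =
    \sum_s bernw t s * L s.
  rewrite /L (wald_identity t x Vd); congr (_ * _).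
  by rewrite /x /t; field.
rewrite waldE.
have pt c s : 1 + c - expR c * expR (- L s) <= L s.
  by rewrite -expRD; have := expR_ge1Dx (c + - L s); lra.
have step (B : pred {ffun T -> bool}) c :
    \sum_(s | B s) bernw t s * expR (- L s) = \sum_(s | B s) bernw t' s ->
    (1 + c) * (\sum_(s | B s) bernw t s) - expR c * (\sum_(s | B s) bernw t' s)
    <= \sum_(s | B s) bernw t s * L s.
  move=> <-; rewrite !mulr_sumr -sumrB; apply: ler_sum => s _.
  have /bernw_ge0 w0 : 0 <= t <= 1 by move: t01 => /andP[/ltW -> /ltW ->].
  have := ler_wpM2l (w0 _ s) (pt c s); lra.
(* The tangent inequality is sharp where [L] equals [l] on [A] and - [l] off [A]; the two slopes
   encode the two decisions. *)
have := step A l likA; have := step (predC A) (- l) likAC => /=.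
have /esym := sum_bernw T t; have /esym := sum_bernw T t'.
rewrite [in X in _ = X -> _](bigID A)/= => e1.
rewrite [in X in _ = X -> _](bigID A)/= => e2.
rewrite [in X in _ -> _ -> _ <= X](bigID A)/=.
move: e1 e2.
set a := \sum_(s | A s) bernw t' s; set b := \sum_(s | ~~ A s) bernw t' s.
set a' := \sum_(s | A s) bernw t s; set b' := \sum_(s | ~~ A s) bernw t s.
move=> /esym/(canRL (addrK _)) -> /esym/(canRL (addrK _)) ->; lra.
Qed.

End testing.

(** * Centered norms and the cone classes *)

Section centered_norms.
Context (R : realType) (d : measure_display) (G : measurableType d).
Variable pi : probability G R.
Implicit Types (f g : G -> R) (p q : \bar R) (r : R) (A : set G).

Lemma measure_setT : (pi : {measure set G -> \bar R}) setT = 1%E.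
Proof. exact: probability_setT. Qed.

Lemma Lfun_measurable q f : f \in Lfun pi q -> measurable_fun setT f.
Proof. by move/sub_Lfun_mfun; rewrite inE. Qed.

Lemma Lfun_norm_lty q f : f \in Lfun pi q -> ('N[pi]_q[EFin \o f] < +oo)%E.
Proof. by move/sub_Lfun_finLfun; rewrite inE. Qed.

Lemma LfunI q f : measurable_fun setT f -> ('N[pi]_q[EFin \o f] < +oo)%E ->
  f \in Lfun pi q.
Proof. by move=> mf nf; rewrite inE; apply/andP; split; rewrite inE. Qed.

Lemma measurable_norm_powR f r : measurable_fun setT f ->
  measurable_fun setT (fun x => `|f x| `^ r).
Proof.
move=> mf; apply: (@measurableT_comp _ _ _ _ _ _ (@powR R ^~ r)) => //.
exact: measurableT_comp.
Qed.

Lemma Lnorm_powE f r : ('N[pi]_(r%:E)[EFin \o f] =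
  (\int[pi]_x (`|f x| `^ r)%:E) `^ r^-1)%E.
Proof. by rewrite unlock. Qed.

Lemma Lnorm_le_bound q f (B : R) : (1 <= q)%E -> measurable_fun setT f ->
  (forall x, `|f x| <= B) -> ('N[pi]_q[EFin \o f] <= B%:E)%E.
Proof.
move=> q1 mf fB; have B0 : 0 <= B by exact: le_trans (fB point).
case: q q1 => [r r1| _|//]; last first.
  rewrite unlock; case: ifPn => _; last by rewrite lee_fin.
  by apply: ess_sup_ler => x; rewrite lee_fin.
rewrite lee_fin in r1; have r0 : 0 < r by rewrite (lt_le_trans ltr01).
rewrite Lnorm_powE; apply: (@le_trans _ _ ((B `^ r)%:E `^ r^-1)%E); last first.
  by rewrite poweR_EFin -powRrM mulfV ?gt_eqF// powRr1.
have int_le : (\int[pi]_x (`|f x| `^ r)%:E <= (B `^ r)%:E)%E.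
  apply: (@le_trans _ _ (\int[pi]_x (cst (B `^ r)%:E x))%E); last first.
    by rewrite integral_cst// measure_setT mule1.
  apply: ge0_le_integral => //.
  - exact/measurable_EFinP/measurable_norm_powR.
  - by move=> x _ /=; rewrite lee_fin ge0_ler_powR ?nnegrE// ltW.
rewrite gt0_ler_poweR ?invr_ge0 ?(ltW r0)// in_itv/= leey andbT.
  by apply: integral_ge0 => x _; rewrite lee_fin powR_ge0.
by rewrite lee_fin powR_ge0.
Qed.

Lemma Lnorm_ge_bound r f (b : R) : 1 <= r -> measurable_fun setT f -> 0 <= b ->
  (forall x, b <= `|f x|) -> (b%:E <= 'N[pi]_(r%:E)[EFin \o f])%E.
Proof.
move=> r1 mf b0 fb; have r0 : 0 < r by rewrite (lt_le_trans ltr01).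
rewrite Lnorm_powE; apply: (@le_trans _ _ ((b `^ r)%:E `^ r^-1)%E).
  by rewrite poweR_EFin -powRrM mulfV ?gt_eqF// powRr1.
have int_le : ((b `^ r)%:E <= \int[pi]_x (`|f x| `^ r)%:E)%E.
  apply: (@le_trans _ _ (\int[pi]_x (cst (b `^ r)%:E x))%E).
    by rewrite integral_cst// measure_setT mule1.
  apply: ge0_le_integral => //.
  - by move=> x _; rewrite lee_fin powR_ge0.
  - exact/measurable_EFinP/measurable_norm_powR.
  - by move=> x _ /=; rewrite lee_fin ge0_ler_powR ?nnegrE// ltW.
rewrite gt0_ler_poweR ?invr_ge0 ?(ltW r0)// in_itv/= leey andbT.
  by rewrite lee_fin powR_ge0.
by apply: integral_ge0 => x _; rewrite lee_fin powR_ge0.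
Qed.

Lemma Lfun_bounded q f (B : R) : (1 <= q)%E -> measurable_fun setT f ->
  (forall x, `|f x| <= B) -> f \in Lfun pi q.
Proof.
move=> q1 mf fB; apply: LfunI => //.
by rewrite (le_lt_trans (Lnorm_le_bound q1 mf fB))// ltry.
Qed.

Lemma Lfun_ge1_integrable q f : (1 <= q)%E -> f \in Lfun pi q ->
  pi.-integrable setT (EFin \o f).
Proof.
move=> q1 fq; apply/Lfun1_integrable.
by apply: (Lfun_subset _ q1) fq => //; rewrite measure_setT.
Qed.

Lemma INTD q f g : (1 <= q)%E -> f \in Lfun pi q -> g \in Lfun pi q ->
  INT pi (f \+ g) = INT pi f + INT pi g.
Proof.
move=> q1 fq gq; rewrite /INT RintegralD//.
  exact: (Lfun_ge1_integrable q1 fq).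
exact: (Lfun_ge1_integrable q1 gq).
Qed.

Lemma INTZ q c f : (1 <= q)%E -> f \in Lfun pi q ->
  INT pi (fun x => c * f x) = c * INT pi f.
Proof.
by move=> q1 fq; rewrite /INT RintegralZl//; exact: (Lfun_ge1_integrable q1 fq).
Qed.

Lemma INT_cst c : INT pi (cst c) = c.
Proof. by rewrite /INT Rintegral_cst// measure_setT mulr1. Qed.

Lemma INT_indic A : measurable A -> INT pi (\1_A) = fine (pi A).
Proof. by move=> mA; rewrite /INT /Rintegral integral_indic// setIT. Qed.

Lemma LfunD q f g : (1 <= q)%E -> f \in Lfun pi q -> g \in Lfun pi q ->
  f \+ g \in Lfun pi q.
Proof. by move=> q1 fq gq; exact: (Lfun_addr_closed pi q1).2. Qed.


Lemma LfunZ q c f : (1 <= q)%E -> f \in Lfun pi q ->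
  (fun x => c * f x) \in Lfun pi q.
Proof.
move=> q1 fq; apply: LfunI.
  by apply: measurable_funM => //; exact: Lfun_measurable fq.
have := LnormZ (Lfun_Sub q1 fq) c => /= ->.
by rewrite lte_mul_pinfty ?lee_fin// Lfun_norm_lty.
Qed.

Lemma measurable_center f : measurable_fun setT f ->
  measurable_fun setT (f \- cst (INT pi f)).
Proof. by move=> mf; exact: measurable_funB. Qed.

Lemma Lfun_center q f : (1 <= q)%E -> f \in Lfun pi q ->
  f \- cst (INT pi f) \in Lfun pi q.
Proof.
move=> q1 fq; apply: (@LfunD q f (cst (- INT pi f))) => //.
apply: (@Lfun_bounded q _ `|INT pi f|) => //.
by move=> x /=; rewrite normrN.
Qed.

Lemma centered_norm_lty q f : (1 <= q)%E -> f \in Lfun pi q ->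
  (centered_norm pi q f < +oo)%E.
Proof. by move=> q1 fq; exact/Lfun_norm_lty/Lfun_center. Qed.

Lemma centerD q f g : (1 <= q)%E -> f \in Lfun pi q -> g \in Lfun pi q ->
  (f \+ g) \- cst (INT pi (f \+ g)) =
  (f \- cst (INT pi f)) \+ (g \- cst (INT pi g)).
Proof.
by move=> q1 fq gq; rewrite (INTD q1 fq gq); apply/funext => x /=; ring.
Qed.

Lemma centered_normD q f g : (1 <= q)%E ->
  f \in Lfun pi q -> g \in Lfun pi q ->
  (centered_norm pi q (f \+ g)%R <=
   centered_norm pi q f + centered_norm pi q g)%E.
Proof.
move=> q1 fq gq; rewrite /centered_norm (centerD q1 fq gq).
by apply: eminkowski => //;
  apply: measurable_center; apply: Lfun_measurable; eassumption.
Qed.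

Lemma centered_norm_subD r f g : 1 <= r ->
  f \in Lfun pi r%:E -> g \in Lfun pi r%:E ->
  (centered_norm pi r%:E g <=
   centered_norm pi r%:E (f \+ g)%R + centered_norm pi r%:E f)%E.
Proof.
move=> r1 fr gr; rewrite /centered_norm (@centerD r%:E)//.
rewrite [X in (_ <= 'N[_]_(_)[EFin \o X] + _)%E](_ : _ =
    (g \- cst (INT pi g)) \+ (f \- cst (INT pi f))); last first.
  by apply/funext => x /=; rewrite addrC.
by apply: lerB_DLnorm => //;
  apply: measurable_center; apply: Lfun_measurable; eassumption.
Qed.

Lemma centered_normZ q c f : (1 <= q)%E -> 0 <= c -> f \in Lfun pi q ->
  (centered_norm pi q (fun x => c * f x)%R = c%:E * centered_norm pi q f)%E.
Proof.
move=> q1 c0 fq; rewrite /centered_norm (INTZ c q1 fq).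
have := LnormZ (Lfun_Sub q1 (Lfun_center q1 fq)) c.
rewrite ger0_norm// => <-; congr Lnorm; apply/funext => x /=.
by rewrite -mulrBr.
Qed.

Lemma prob_fin_num A : measurable A -> (pi A \is a fin_num).
Proof. exact: fin_num_measure. Qed.

Lemma Lfun_indic q A : (1 <= q)%E -> measurable A ->
  (\1_A : G -> R) \in Lfun pi q.
Proof.
move=> q1 mA; apply: (@Lfun_bounded _ _ 1) => // x.
by rewrite indicE; case: (_ \in _); rewrite ?normr1 ?normr0.
Qed.

(** The r-th absolute central moment of a Bernoulli variable of mean [a]: a centered indicator has
    modulus 1 - a on the set and a off it. *)
Definition bernoulli_moment (a r : R) := a * (1 - a) `^ r + (1 - a) * a `^ r.

Lemma centered_norm_indic r A : 1 <= r -> measurable A ->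
  (centered_norm pi r%:E (\1_A) =
   (bernoulli_moment (fine (pi A)) r `^ r^-1)%:E)%E.
Proof.
move=> r1 mA; rewrite /centered_norm INT_indic// Lnorm_powE -poweR_EFin.
congr (_ `^ _)%E; set a := fine (pi A).
have piA : pi A = a%:E by rewrite fineK ?prob_fin_num.
have piAC : pi (~` A) = (1 - a)%:E by rewrite probability_setC// piA.
have a01 : 0 <= a <= 1.
  by rewrite -!lee_fin -piA measure_ge0/=; exact: probability_le1.
transitivity (\int[pi]_x (((1 - a) `^ r * \1_A x)%:E +
    (a `^ r * \1_(~` A) x)%:E))%E.
  apply: eq_integral => x _; rewrite -EFinD /= !indicE in_setC/=.
  case: (x \in A) => /=; congr EFin.
    by rewrite mulr1 mulr0 addr0 ger0_norm//; lra.
  by rewrite mulr1 mulr0 !add0r normrN ger0_norm//; lra.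
rewrite ge0_integralD//; first last.
- apply/measurable_EFinP/measurable_funM => //; apply: measurable_indic.
  exact: measurableC.
- by move=> x _; rewrite lee_fin mulr_ge0 ?powR_ge0.
- by apply/measurable_EFinP/measurable_funM.
- by move=> x _; rewrite lee_fin mulr_ge0 ?powR_ge0.
have int_indic c (B : set G) : measurable B -> 0 <= c ->
    (\int[pi]_x (c * \1_B x)%:E = c%:E * pi B)%E.
  move=> mB c0; under eq_integral do rewrite EFinM.
  rewrite ge0_integralZl_EFin//.
    by rewrite integral_indic// setIT.
  exact/measurable_EFinP/measurable_indic.
rewrite !int_indic ?powR_ge0//; last exact: measurableC.
by rewrite piA piAC -!EFinM -EFinD /bernoulli_moment mulrC [X in _ + X]mulrC.
Qed.

End centered_norms.

(** * Comparison of Bernoulli moments of different orders *)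

Section bernoulli_moments.
Context (R : realType).
Implicit Types (a p q r : R).

(** The power a^(1/r), which decides the norm ratio, is isolated; the last factor is at least 1 and
    can be compared between orders. *)
Lemma bernoulli_momentE a r : 0 < a < 1 -> 1 <= r ->
  bernoulli_moment a r `^ r^-1 =
  a `^ r^-1 * (1 - a) * (1 + (a / (1 - a)) `^ (r - 1)) `^ r^-1.
Proof.
move=> /andP[a0 a1] r1; have r0 : 0 < r by lra.
have b0 : 0 < 1 - a by lra.
have -> : bernoulli_moment a r =
    a * (1 - a) `^ r * (1 + (a / (1 - a)) `^ (r - 1)).
  rewrite /bernoulli_moment powRM ?invr_ge0 1?ltW// -powR_inv1 ?ltW//.
  rewrite -powRrM mulN1r powRN -(mulr_powRB1 (ltW a0) r0).
  rewrite -(mulr_powRB1 (ltW b0) r0).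
  by field; rewrite gt_eqF// powR_gt0.
rewrite powRM ?mulr_ge0 ?addr_ge0 ?powR_ge0 1?ltW//.
rewrite powRM ?powR_ge0 1?ltW//.
by rewrite -(powRrM (1 - a)) mulfV ?gt_eqF// powRr1 1?ltW.
Qed.

Lemma bernoulli_moment_ge a r : 0 < a < 1 -> 1 <= r ->
  a `^ r^-1 * (1 - a) <= bernoulli_moment a r `^ r^-1.
Proof.
move=> a01 r1; have /andP[a0 a1] := a01; rewrite bernoulli_momentE//.
rewrite ler_peMr ?mulr_ge0 ?powR_ge0//; first by lra.
rewrite -[leLHS](powRr0 (1 + (a / (1 - a)) `^ (r - 1))) ler_powR//.
  by rewrite lerDl powR_ge0.
by rewrite invr_ge0; lra.
Qed.

(* For [x = a / (1 - a) <= 1] the factor [(1 + x^(r-1))^(1/r)] is nonincreasing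
   in [r]. *)
Lemma bernoulli_moment_ratio a p q : 0 < a <= 2^-1 -> 1 <= p -> p <= q ->
  bernoulli_moment a q `^ q^-1 <=
  a `^ (q^-1 - p^-1) * bernoulli_moment a p `^ p^-1.
Proof.
move=> /andP[a0 ah] p1 pq; have a01 : 0 < a < 1 by apply/andP; split; lra.
have x1 : a / (1 - a) <= 1 by rewrite ler_pdivrMr; lra.
have x0 : 0 < a / (1 - a) by rewrite divr_gt0; lra.
rewrite !bernoulli_momentE//; last by lra.
rewrite !mulrA -powRD; last by rewrite (gt_eqF a0) implybT.
rewrite subrK.
rewrite ler_wpM2l ?mulr_ge0 ?powR_ge0//; first by lra.
set y := 1 + _ `^ (p - 1).
have y1 : 1 <= y by rewrite lerDl powR_ge0.
apply: (@le_trans _ _ (y `^ q^-1)).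
  rewrite ge0_ler_powR ?invr_ge0 ?nnegrE ?addr_ge0 ?powR_ge0//; first by lra.
  by rewrite lerD2l ger_powR ?x0// lerD2r.
by rewrite ler_powR// lef_pV2 ?posrE//; lra.
Qed.

(** Both summands of the moment are at most a, and 2^(1/r) <= 2. *)
Lemma bernoulli_moment_le a r : 0 < a <= 2^-1 -> 1 <= r ->
  bernoulli_moment a r `^ r^-1 <= 2 * a `^ r^-1.
Proof.
move=> /andP[a0 ah] r1; have r0 : 0 < r by lra.
have a_le : a `^ r <= a by rewrite ge1r_powR// a0; lra.
have b_le : (1 - a) `^ r <= 1.
  rewrite (le_trans (@ge1r_powR _ (1 - a) r _ r1))//; last by lra.
  by apply/andP; split; lra.
apply: (@le_trans _ _ ((2 * a) `^ r^-1)).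
  rewrite ge0_ler_powR ?invr_ge0 ?nnegrE ?(ltW r0)//.
  - by rewrite addr_ge0 ?mulr_ge0 ?powR_ge0 ?(ltW a0)//; lra.
  - by rewrite mulr_ge0 ?(ltW a0).
  - by rewrite /bernoulli_moment; have := powR_ge0 (1 - a) r; nra.
rewrite powRM ?(ltW a0)// ler_wpM2r ?powR_ge0//.
by rewrite ler1_powR ?ler1n// invf_le1.
Qed.

End bernoulli_moments.

(** * Indicators inside the cone, and rays that stay in it *)

Section cones.
Context (R : realType) (d : measure_display) (G : measurableType d).
Variable pi : probability G R.
Implicit Types (f g : G -> R) (p K : R) (q : \bar R) (A : set G).

(** The exponent is the inverse of 1/p - 1/q with 1/q = 0 at infinity, which puts finite and
    infinite q in one formula. *)
Lemma cone_exponentE p q : 0 < p -> (p%:E < q)%E ->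
  cone_exponent p q = (p^-1 - (if q is q'%:E then q'^-1 else 0))^-1.
Proof.
case: q => [q| |]//= p0; last by rewrite subr0 invrK.
by rewrite lte_fin => pq; field; lra.
Qed.

Lemma fine_prob01 A : measurable A -> 0 <= fine (pi A) <= 1.
Proof.
move=> mA; rewrite -!lee_fin fineK ?prob_fin_num// measure_ge0/=.
exact: probability_le1.
Qed.

(** The norm ratio is at most a^(1/q - 1/p), and this is below K once a > K^(-r) with r the cone
    exponent. Strictness leaves the slack that [cone_ray] spends on [f]. *)
Lemma cone_indic p q K A : 1 <= p -> (p%:E < q)%E -> 0 < K -> measurable A ->
  K `^ (- cone_exponent p q) < fine (pi A) <= 2^-1 ->
  (centered_norm pi q \1_A < K%:E * centered_norm pi p%:E \1_A)%E.
Proof.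
move=> p1 pq K0 mA; set a := fine (pi A) => /andP[Ka ah].
have a0 : 0 < a by rewrite (le_lt_trans _ Ka)// powR_ge0.
have a01 : 0 < a < 1 by apply/andP; split => //; lra.
have p0 : 0 < p by lra.
have ie : a `^ (- (cone_exponent p q)^-1) < K.
  have e0 : 0 < cone_exponent p q.
    rewrite cone_exponentE// invr_gt0; case: q pq {Ka} => [q| |]//=.
      by rewrite lte_fin => pq; rewrite subr_gt0 ltf_pV2 ?posrE//; lra.
    by rewrite subr0 invr_gt0.
  rewrite powRN -ltf_pV2 ?posrE ?invr_gt0 ?powR_gt0// invrK.
  rewrite -(powR_inv1 (ltW K0)).
  have -> : -1 = - cone_exponent p q * (cone_exponent p q)^-1.
    by rewrite mulNr mulfV// gt_eqF.
  by rewrite powRrM gt0_ltr_powR ?invr_gt0 ?nnegrE ?powR_ge0// ltW.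
have mom0 : 0 < bernoulli_moment a p `^ p^-1.
  rewrite (lt_le_trans _ (bernoulli_moment_ge a01 p1))// mulr_gt0 ?powR_gt0//.
  by lra.
rewrite (centered_norm_indic _ p1)//.
apply: (@le_lt_trans _ _
    (a `^ (- (cone_exponent p q)^-1) * bernoulli_moment a p `^ p^-1)%:E);
  last first.
  by rewrite -EFinM lte_fin ltr_pM2r.
rewrite cone_exponentE// invrK; case: q pq {Ka ie} => [q| |]//=.
  rewrite lte_fin => pq; rewrite centered_norm_indic//; last by lra.
  by rewrite lee_fin opprB bernoulli_moment_ratio ?a0// ltW.
(* For infinite q the sup norm is at most 1 - a, as a <= 1/2, while the p-norm is at least a^(1/p)
   (1 - a). *)
move=> _; apply: (@le_trans _ _ (1 - a)%:E).
  apply: Lnorm_le_bound; rewrite ?leey => //.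
    by apply: measurable_center; exact: measurable_indic.
  move=> x /=; rewrite INT_indic// -/a indicE.
  by case: (x \in A) => /=; rewrite ler_norml; apply/andP; split; lra.
rewrite lee_fin subr0 -ler_pdivrMl ?powR_gt0// -powRN opprK.
exact: bernoulli_moment_ge.
Qed.

(** The modulus of the centered indicator stays in [b, 1 - b], so its norms of all orders differ by
    a factor at most (1 - b)/b < K. Unlike [cone_indic], this allows measures on both sides of
    1/2. *)
Lemma cone_indic_half p q K b A : 1 <= p -> (p%:E < q)%E -> 0 < K ->
  measurable A -> b <= fine (pi A) <= 1 - b -> 0 <= b -> 1 - b < K * b ->
  (centered_norm pi q \1_A < K%:E * centered_norm pi p%:E \1_A)%E.
Proof.
move=> p1 pq K0 mA; set a := fine (pi A) => /andP[ba ab] b0 bK.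
have mc : measurable_fun setT (\1_A \- cst (INT pi \1_A) : G -> R).
  by apply: measurable_center; exact: measurable_indic.
have q1 : (1 <= q)%E by rewrite (le_trans _ (ltW pq)).
apply: (@le_lt_trans _ _ (1 - b)%:E).
  apply: Lnorm_le_bound => // x /=; rewrite INT_indic// -/a indicE.
  by case: (x \in A) => /=; rewrite ler_norml; apply/andP; split; lra.
apply: (@lt_le_trans _ _ (K * b)%:E); first by rewrite lte_fin.
rewrite EFinM lee_pmul2l//; apply: Lnorm_ge_bound => // x /=.
rewrite INT_indic// -/a indicE; case: (x \in A) => /=.
  by rewrite ger0_norm; lra.
by rewrite sub0r normrN ger0_norm; lra.
Qed.

(* Far along the ray in direction [g] the contribution of [f] is negligible. *)
Lemma cone_ray p q K f g : 1 <= p -> (p%:E < q)%E -> 0 < K ->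
  f \in Lfun pi q -> g \in Lfun pi q ->
  (centered_norm pi q g < K%:E * centered_norm pi p%:E g)%E ->
  exists c0, 0 < c0 /\ forall c, c0 <= c ->
    cone_class pi p%:E q K (f \+ (fun x => c * g x)).
Proof.
move=> p1 pq K0 fq gq; have p1' : (1 <= p%:E)%E by [].
have q1 : (1 <= q)%E by rewrite (le_trans _ (ltW pq)).
have sub h : h \in Lfun pi q -> h \in Lfun pi p%:E.
  apply: (Lfun_subset p1' q1); last exact: ltW.
  by rewrite measure_setT.
have fin h r : (1 <= r)%E -> h \in Lfun pi r ->
    exists2 u, 0 <= u & centered_norm pi r h = u%:E.
  move=> r1 hr; exists (fine (centered_norm pi r h)).
    by rewrite fine_ge0// Lnorm_ge0.
  by rewrite fineK// ge0_fin_numE ?Lnorm_ge0// centered_norm_lty.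
have [Fq Fq0 FqE] := fin f q q1 fq.
have [Fp Fp0 FpE] := fin f p%:E p1' (sub f fq).
have [u u0 uE] := fin g q q1 gq; have [v v0 vE] := fin g p%:E p1' (sub g gq).
rewrite uE vE -EFinM lte_fin => uv.
have D0 : 0 < K * v - u by rewrite subr_gt0.
have E0 : 0 <= (Fq + K * Fp) / (K * v - u).
  exact: divr_ge0 (addr_ge0 Fq0 (mulr_ge0 (ltW K0) Fp0)) (ltW D0).
(* The quotient solves Fq + c u = K (c v - Fp) for c; the added 1 makes the threshold positive. *)
exists ((Fq + K * Fp) / (K * v - u) + 1); split; first by lra.
move=> c cE; have c0 : 0 <= c by lra.
have cgq : (fun x => c * g x) \in Lfun pi q.
  exact: (LfunZ c q1 gq).
have hq := LfunD q1 fq cgq.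
have [X X0 XE] := fin _ p%:E p1' (sub _ hq).
split => //.
apply: le_trans (centered_normD q1 fq cgq) _.
have := centered_norm_subD p1 (sub _ fq) (sub _ cgq).
rewrite (centered_normZ q1 c0 gq) (centered_normZ p1' c0 (sub _ gq)).
rewrite XE FqE FpE uE vE.
rewrite -!EFinM -!EFinD !lee_fin => Xv.
have : (Fq + K * Fp) <= c * (K * v - u).
  by rewrite -ler_pdivrMr//; lra.
by nra.
Qed.

End cones.

(** * Runs of an algorithm *)

Section equipartition.
Context (R : realType) (d : measure_display) (G : measurableType d).
Variable pi : probability G R.
Hypothesis equi : equipartitionable pi.

(** An equipartition is recorded by the map from a point to its cell, so that one bit per cell
    becomes the function [s (idx x)] on [G]. *)
Definition partition_index (T : finType) (idx : G -> T) := forall j : T,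
  measurable (idx @^-1` [set j]) /\ pi (idx @^-1` [set j]) = (#|T|%:R^-1)%:E.

Lemma equipartition_index (T : finType) : (0 < #|T|)%N ->
  exists idx : G -> T, partition_index idx.
Proof.
move=> /equi[A [mA tA cA pA]].
have /choice[i iA] : forall x, exists j, A j x.
  by move=> x; have : setT x by []; rewrite -cA => -[j _ Ajx]; exists j.
exists (fun x => enum_val (i x)) => j.
suff -> : (fun x => enum_val (i x)) @^-1` [set j] = A (enum_rank j).
  by split.
apply/seteqP; split => x /=.
  by move=> <-; rewrite enum_valK.
move=> Ajx; have -> : i x = enum_rank j.
  by apply: (tA _ _ I I); exists x.
exact: enum_rankK.
Qed.

Variables (T : finType) (idx : G -> T).
Hypothesis idxP : partition_index idx.

Lemma measurable_idx (D : set T) : measurable (idx @^-1` D).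
Proof.
rewrite (_ : idx @^-1` D = \bigcup_(j in D) idx @^-1` [set j]).
  by apply: fin_bigcup_measurable => // j _; exact: (idxP j).1.
by apply/seteqP; split => x /= => [Dx|[j Dj ->//]]; exists (idx x).
Qed.

Definition union_of (s : {ffun T -> bool}) : set G := [set x | s (idx x)].

Lemma measurable_union_of s : measurable (union_of s).
Proof. exact: (measurable_idx [set j | s j]). Qed.

Lemma prob_union_of s : pi (union_of s) = (freq R s)%:E.
Proof.
rewrite -[X in pi X]setIT -integral_indic//; last exact: measurable_union_of.
transitivity (\int[pi]_x (\sum_j ((s j)%:R * \1_(idx @^-1` [set j]) x)%:E))%E.
  apply: eq_integral => x _; rewrite sumEFin; congr EFin.
  have sE : (x \in union_of s) = s (idx x).
    by apply/idP/idP => [/set_mem//|sx]; exact: mem_set.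
  rewrite (bigD1 (idx x))//= big1 => [|j jx].
    have xx : x \in idx @^-1` [set idx x] by exact: mem_set.
    by rewrite addr0 !indicE sE xx mulr1.
  rewrite indicE memNset ?mulr0//= => xj.
  by rewrite xj eqxx in jx.
rewrite ge0_integral_sum//; last first.
  move=> j; apply/measurable_EFinP/measurable_funM => //.
  by apply: measurable_indic; exact: (idxP j).1.
rewrite /freq mulr_suml -sumEFin; apply: eq_bigr => j _.
under eq_integral do rewrite EFinM.
rewrite ge0_integralZl_EFin//; last first.
  by apply/measurable_EFinP/measurable_indic; exact: (idxP j).1.
have [mj pj] := idxP j.
by rewrite integral_indic// setIT [X in (_ * X)%E]pj.
Qed.

End equipartition.

(** * Runs that cannot distinguish two integrands *)

Section algorithm_runs.
Context (R : realType) (d : measure_display) (G : measurableType d).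
Variable Q : randomized_algorithm R G.
Implicit Types (f g : G -> R) (w : Omega Q) (i : nat) (A : set G).

Definition visited f w i : bool := enat_ge (cost Q f w) i.+1.

Definition sample_point f w i : G :=
  node Q i (w, prefix_tuple (information Q f w) i).

(* These runs cannot tell [f] from a function that agrees with it off [A]. *)
Definition missed f A : set (Omega Q) :=
  [set w | forall i, visited f w i -> ~ A (sample_point f w i)].

Lemma information_visited f w i : information Q f w i =
  if visited f w i then f (sample_point f w i) else 0.
Proof. exact: informationE. Qed.

Lemma eq_information f g w :
  (forall i, visited f w i ->
     g (sample_point f w i) = f (sample_point f w i)) ->
  information Q g w = information Q f w.
Proof.
move=> fg; apply/funext => i; elim/ltn_ind: i => i IH.
have eq_prefix : prefix_tuple (information Q g w) i =
    prefix_tuple (information Q f w) i.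
  by apply: eq_from_tnth => j; rewrite !tnth_mktuple IH.
have eq_visited : visited g w i = visited f w i.
  exact: stop_nonanticipating.
rewrite !information_visited eq_visited /sample_point eq_prefix.
by case: ifP => // /fg.
Qed.

Lemma eq_result f g w : information Q g w = information Q f w ->
  result Q g w = result Q f w.
Proof. by rewrite /result => ->. Qed.

Lemma missed_information f g A w : (forall x, ~ A x -> g x = f x) ->
  missed f A w -> information Q g w = information Q f w.
Proof. by move=> fg Aw; apply: eq_information => i /Aw; exact: fg. Qed.

Section measurability.
Variable f : G -> R.
Hypothesis minfo : measurable_fun setT (information Q f).

Lemma measurable_observation : measurable_fun setT
  (fun w => (seed Q w, information Q f w)).
Proof. by apply: measurable_fun_pair. Qed.

Lemma measurable_cost (A : set (option nat)) :
  measurable [set w | A (cost Q f w)].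
Proof.
have := measurable_observation measurableT (measurable_stop (r := Q) A).
by rewrite setTI.
Qed.

Lemma measurable_fun_cost d' (U : measurableType d') (h : option nat -> U) :
  measurable_fun setT (fun w => h (cost Q f w)).
Proof.
by move=> _ Y mY; rewrite setTI; exact: (measurable_cost (h @^-1` Y)).
Qed.

Lemma measurable_result : measurable_fun setT (result Q f).
Proof.
apply: (measurableT_comp (f := output Q)) => //.
exact: measurable_observation.
Qed.

Lemma measurable_coordinate i :
  measurable_fun setT (fun y : realseq R => y i).
Proof.
move=> _ Y mY; rewrite setTI; apply: sub_sigma_algebra.
by exists i => //; exists Y => //; rewrite setTI.
Qed.

Lemma measurable_sample_point i : measurable_fun setT (sample_point f ^~ i).
Proof.
apply: (measurableT_comp (f := node Q i)) => //.
apply: measurable_fun_pair => //.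
apply/measurable_fun_tnthP => j.
rewrite (_ : _ \o _ = (fun y : realseq R => y j) \o information Q f).
  by apply: measurableT_comp => //; exact: measurable_coordinate.
by apply/funext => w /=; rewrite tnth_mktuple.
Qed.

Lemma measurable_missed A : measurable A -> measurable (missed f A).
Proof.
move=> mA; rewrite (_ : missed f A = \bigcap_i
  ([set w | ~ visited f w i] `|` (sample_point f ^~ i) @^-1` (~` A))).
  apply: bigcap_measurable => // i _; apply: measurableU.
    exact: (measurable_cost [set c | ~ enat_ge c i.+1]).
  rewrite -[X in measurable X]setTI.
  by apply: measurable_sample_point => //; exact: measurableC.
apply/seteqP; split => w /= h i => [_|vi].
  by case: (boolP (visited f w i)) => [/h|/negP]; [right|left].
by have [] := h i I.
Qed.

End measurability.

End algorithm_runs.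

Section hits.
Context (R : realType) (d : measure_display) (G : measurableType d).
Variables (Q : randomized_algorithm R G) (T : finType) (idx : G -> T).
Implicit Types (f g : G -> R) (w : Omega Q).

Definition hits f w : {set T} :=
  [set j | `[< exists2 i, visited f w i & idx (sample_point f w i) = j >]]%SET.

Lemma hitsP f w j :
  reflect (exists2 i, visited f w i & idx (sample_point f w i) = j)
          (j \in hits f w).
Proof. by rewrite inE; exact: asboolP. Qed.

Lemma card_hits f w k : cost Q f w = Some k -> (#|hits f w| <= k)%N.
Proof.
move=> fk; pose h (i : 'I_k) := idx (sample_point f w i).
apply: (@leq_trans #|[set h i | i : 'I_k]%SET|); last first.
  by rewrite (leq_trans (leq_imset_card _ _))// card_ord.
apply/subset_leq_card/fintype.subsetP => j /hitsP[i].
by rewrite /visited fk => /= ik <-; apply/imsetP; exists (Ordinal ik).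
Qed.

Lemma card_hits_ereal f w :
  ((#|hits f w|%:R)%:E <= enat_ereal R (cost Q f w))%E.
Proof.
case fk : (cost Q f w) => [k|] /=; last exact: leey.
by rewrite lee_fin ler_nat card_hits.
Qed.

Lemma missed_union_of f (s : {ffun T -> bool}) w :
  missed f (union_of idx s) w <-> [forall j in hits f w, ~~ s j].
Proof.
split=> [h|/forallP h i vi].
  apply/forallP => j; apply/implyP => /hitsP[i vi <-].
  by apply/negP; exact: h.
have /implyP := h (idx (sample_point f w i)).
by move=> /(_ _)/negP; apply; apply/hitsP; exists i.
Qed.

End hits.

(** * Lower bounds from missed sets *)

Section detection.
Context (R : realType) (d : measure_display) (G : measurableType d).
Variable pi : probability G R.
Hypothesis equi : equipartitionable pi.
Variables (Q : randomized_algorithm R G) (f : G -> R).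
Hypothesis minfo : measurable_fun setT (information Q f).

(** The value 0 at infinite cost keeps this a lower bound for the probability of a miss on every
    run. *)
Definition miss_power (t : R) (c : option nat) : R :=
  if c is Some k then (1 - t) ^+ k else 0.

(** For fixed omega the missed configurations have total weight (1 - t)^h, where h counts the
    distinct cells hit. Repeated visits only help: h is at most the cost. Integration over omega is
    exchanged with the finite sum. *)
Lemma expected_miss (T : finType) (idx : G -> T) (t : R) : 0 <= t <= 1 ->
  partition_index pi idx ->
  (\int[Prob Q]_w (miss_power t (cost Q f w))%:E <=
   \sum_(s : {ffun T -> bool}) (bernw t s)%:E *
     Prob Q (missed f (union_of idx s)))%E.
Proof.
move=> t01 idxP.
have mm s : measurable (missed (Q := Q) f (union_of idx s)).
  exact/measurable_missed/(measurable_union_of idxP).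
apply: (@le_trans _ _ (\int[Prob Q]_w \sum_(s : {ffun T -> bool})
    (bernw t s * \1_(missed f (union_of idx s)) w)%:E)%E); last first.
  rewrite ge0_integral_sum//; last 2 first.
  - by move=> s; apply/measurable_EFinP/measurable_funM.
  - by move=> s w _; rewrite lee_fin mulr_ge0 ?bernw_ge0.
  apply: lee_sum => s _; under eq_integral do rewrite EFinM.
  rewrite ge0_integralZl_EFin ?bernw_ge0//; last first.
    exact/measurable_EFinP/measurable_indic.
  by rewrite integral_indic// setIT.
have mpow : measurable_fun setT (fun w : Omega Q => miss_power t (cost Q f w)).
  exact: (measurable_fun_cost minfo (miss_power t)).
have pow0 c : 0 <= miss_power t c.
  by case: c => //= k; rewrite exprn_ge0; lra.
apply: ge0_le_integral => //.
- by move=> w _; rewrite lee_fin.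
- exact/measurable_EFinP.
- by apply: emeasurable_sum => s; apply/measurable_EFinP/measurable_funM.
- move=> w _; rewrite sumEFin lee_fin.
  have -> : \sum_(s : {ffun T -> bool})
      bernw t s * \1_(missed f (union_of idx s)) w = (1 - t) ^+ #|hits idx f w|.
    rewrite -sum_bernw_avoid [RHS]big_mkcond; apply: eq_bigr => s _.
    rewrite indicE; case: ifPn => [|] h.
      by rewrite mem_set ?mulr1//; exact/missed_union_of.
    by rewrite memNset ?mulr0// => /missed_union_of; rewrite (negbTE h).
  rewrite /miss_power; case fk: (cost Q f w) => [k|]; last first.
    by rewrite exprn_ge0; lra.
  by rewrite ler_wiXn2l ?card_hits//; lra.
Qed.

(** Typical configurations obey the bound [rho]; the atypical ones are estimated by 1 and carry
    little weight. *)
Lemma sum_bernw_le (T : finType) (t eta rho : R)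
    (m : {ffun T -> bool} -> \bar R) :
  0 <= t <= 1 -> 0 < eta -> 0 <= rho -> (0 < #|T|)%N ->
  (forall s, m s <= 1)%E ->
  (forall s, `|freq R s - t| < eta -> (m s <= rho%:E)%E) ->
  (\sum_s (bernw t s)%:E * m s <= (rho + (#|T|%:R * eta ^+ 2)^-1)%:E)%E.
Proof.
move=> t01 eta0 rho0 T0 m1 mrho.
pose bad (s : {ffun T -> bool}) := eta <= `|freq R s - t|.
rewrite (bigID bad)/= addeC EFinD leeD//.
  apply: (@le_trans _ _ (\sum_(s | ~~ bad s) (bernw t s * rho)%:E)%E).
    apply: lee_sum => s; rewrite /bad -ltNge => st.
    by rewrite EFinM lee_wpmul2l ?lee_fin ?bernw_ge0// mrho.
  rewrite sumEFin lee_fin -mulr_suml ler_piMl//.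
  rewrite -(sum_bernw T t) [leRHS](bigID bad)/= lerDr.
  by apply: sumr_ge0 => s _; exact: bernw_ge0.
apply: (@le_trans _ _ (\sum_(s | bad s) (bernw t s)%:E)%E).
  apply: lee_sum => s _; rewrite -[leRHS]mule1.
  by rewrite lee_wpmul2l ?lee_fin ?bernw_ge0.
by rewrite sumEFin lee_fin freq_concentration.
Qed.

Lemma small_cells (eta e : R) : 0 < eta -> 0 < e ->
  exists n : nat, (#|'I_n.+1|%:R * eta ^+ 2)^-1 <= e.
Proof.
move=> eta0 e0; exists (Num.truncn ((e * eta ^+ 2)^-1)).
rewrite card_ord invf_ple ?posrE ?mulr_gt0 ?exprn_gt0//.
have nP := truncnS_gt ((e * eta ^+ 2)^-1).
by rewrite -ler_pdivrMr ?exprn_gt0// -invfM (le_trans _ (ltW nP)).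
Qed.

(* A random union of many small cells has measure close to [t], and a run of
   cost [k] misses it with probability at least [(1 - t)^k]. *)
Lemma detection (t eta rho : R) : 0 <= t <= 1 -> 0 < eta -> 0 <= rho ->
  (forall A, measurable A -> `|fine (pi A) - t| < eta ->
     (Prob Q (missed f A) <= rho%:E)%E) ->
  (\int[Prob Q]_w (miss_power t (cost Q f w))%:E <= rho%:E)%E.
Proof.
move=> t01 eta0 rho0 missP; apply/lee_addgt0Pr => e e0.
have [n nP] := small_cells eta0 e0.
have T0 : (0 < #|'I_n.+1|)%N by rewrite card_ord.
have [idx idxP] := equipartition_index equi T0.
apply: le_trans (expected_miss t01 idxP) _.
apply: (le_trans (sum_bernw_le t01 eta0 rho0 T0 _ _)) => [s|s st|].
- exact: probability_le1 (measurable_missed minfo (measurable_union_of idxP s)).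
- apply: missP; first exact: (measurable_union_of idxP).
  by rewrite (prob_union_of idxP).
- by rewrite -EFinD lee_fin lerD2l.
Qed.

End detection.

(** * Continuity from above and tightness *)

Section tightness.
Context (R : realType) (d : measure_display) (T : measurableType d).
Variable P : probability T R.

Lemma prob_vanishing (F : nat -> set T) (e : R) : 0 < e ->
  (forall n, measurable (F n)) -> (forall n, F n.+1 `<=` F n) ->
  P.-negligible (\bigcap_n F n) -> exists n, (P (F n) <= e%:E)%E.
Proof.
move=> e0 mF dF negF.
have mcap : measurable (\bigcap_n F n) by exact: bigcap_measurable.
have nF : nonincreasing_seq F.
  by apply/nonincreasing_seqP => n; apply/subsetPset; exact: dF.
have F0 : (P (F 0%N) < +oo)%E.
  by rewrite (le_lt_trans (probability_le1 P (mF 0%N)))// ltry.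
have := nonincreasing_cvg_mu F0 mF mcap nF.
rewrite (measure_negligible mcap negF) => /fine_cvgP[fF].
move=> /cvgrPdist_le/(_ _ e0) [n _ /(_ n (leqnn n))]/=.
rewrite sub0r normrN => Fe; exists n.
rewrite -(fineK (fin_num_measure P _ (mF n))) lee_fin.
exact: le_trans (ler_norm _) Fe.
Qed.

Lemma prob_tight (X : T -> R) (e : R) : 0 < e -> measurable_fun setT X ->
  exists n : nat, (P [set w | n%:R < `|X w|]%R <= e%:E)%E.
Proof.
move=> e0 mX; apply: prob_vanishing => // [n|n w /=|].
- rewrite -[X in measurable X]setTI.
  apply: (measurable_fun_ltr (f := fun=> n%:R) (g := fun w => `|X w|)) => //.
  exact: measurableT_comp.
- by apply: le_lt_trans; rewrite ler_nat.
- rewrite (_ : \bigcap_n _ = set0); first exact: negligible_set0.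
  apply/seteqP; split => // w /(_ (Num.truncn `|X w|).+1 I)/=.
  by rewrite ltNge ltW// truncnS_gt.
Qed.

End tightness.

(** * From miss probabilities to the cost *)

Section lower_bounds.
Context (R : realType) (d : measure_display) (G : measurableType d).
Variables (Q : randomized_algorithm R G) (f : G -> R).
Hypothesis minfo : measurable_fun setT (information Q f).

Lemma measurable_enat_cost :
  measurable_fun setT (fun w => enat_ereal R (cost Q f w)).
Proof. exact: (measurable_fun_cost minfo (enat_ereal R)). Qed.

Lemma measurable_miss_power (t : R) :
  measurable_fun setT (fun w => miss_power t (cost Q f w)).
Proof. exact: (measurable_fun_cost minfo (miss_power t)). Qed.

Lemma miss_power_ge0 (t : R) c : 0 <= t <= 1 -> 0 <= miss_power t c.
Proof. by move=> t01; case: c => //= k; rewrite exprn_ge0; lra. Qed.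

Lemma enat_ereal_ge0 c : (0 <= enat_ereal R c)%E.
Proof. by case: c => //= k; rewrite lee_fin. Qed.

(* Jensen's inequality for [x |-> (1 - t)^x], through its tangent at the mean
   cost. *)
Lemma mean_cost_ge (t rho : R) : 0 < t < 1 -> 0 < rho ->
  (\int[Prob Q]_w (miss_power t (cost Q f w))%:E <= rho%:E)%E ->
  ((ln rho^-1 / ln (1 - t)^-1)%:E <= mean_cost Q f)%E.
Proof.
move=> t01 rho0 le_rho; have /andP[t0 t1] := t01.
have t01' : 0 <= t <= 1 by apply/andP; split; lra.
set l := ln (1 - t)^-1.
have l0 : 0 < l by rewrite ln_gt0// invf_gt1; lra.
have powE k : (1 - t) ^+ k = expR (- (l * k%:R)).
  have b0 : 0 < 1 - t by lra.
  rewrite /l lnV ?posrE// mulNr opprK mulr_natr -lnXn// lnK// posrE.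
  exact: exprn_gt0.
have : (0 <= mean_cost Q f)%E.
  by apply: integral_ge0 => w _; exact: enat_ereal_ge0.
case E : (mean_cost Q f) => [x| |]// x0; last exact: leey.
rewrite lee_fin in x0; rewrite lee_fin ler_pdivrMr//.
pose C := expR (- (l * x)).
have C0 : 0 < C by exact: expR_gt0.
have : ((C * (1 + l * x))%:E <=
    \int[Prob Q]_w ((miss_power t (cost Q f w))%:E +
      (C * l)%:E * enat_ereal R (cost Q f w)))%E.
  apply: (@le_trans _ _ (\int[Prob Q]_w (cst (C * (1 + l * x))%:E w))%E).
    by rewrite integral_cst// measure_setT mule1.
  apply: ge0_le_integral => //.
  - by move=> w _; rewrite lee_fin mulr_ge0 ?addr_ge0 ?mulr_ge0// ltW.
  - apply: emeasurable_funD; first exact/measurable_EFinP/measurable_miss_power.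
    by apply: measurable_funeM; exact: measurable_enat_cost.
  - move=> w _ /=; case: (cost Q f w) => [k|] /=; last first.
      by rewrite gt0_muley ?lte_fin ?mulr_gt0// addey// leey.
    rewrite -EFinM -EFinD lee_fin powE.
    have -> : - (l * k%:R) = - (l * x) + (l * x - l * k%:R) by ring.
    rewrite expRD -/C -mulrA -mulrDr ler_pM2l//.
    by have := expR_ge1Dx (l * x - l * k%:R); lra.
rewrite ge0_integralD//; last 4 first.
- by move=> w _; rewrite lee_fin miss_power_ge0.
- exact/measurable_EFinP/measurable_miss_power.
- by move=> w _; rewrite mule_ge0 ?enat_ereal_ge0// lee_fin mulr_ge0 ?ltW.
- by apply: measurable_funeM; exact: measurable_enat_cost.
rewrite ge0_integralZl_EFin//; last 3 first.
- by move=> w _; exact: enat_ereal_ge0.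
- exact: measurable_enat_cost.
- by rewrite mulr_ge0 ?ltW.
rewrite -/(mean_cost Q f) E => /le_trans/(_ (leeD2r _ le_rho)).
rewrite -EFinM -EFinD lee_fin => h.
(* The linear term C l x cancels on both sides because the tangent was taken at the mean cost
   itself. *)
have {h} : C <= rho by nra.
rewrite -(ler_ln C0 rho0) /C expRK lnV ?posrE//; lra.
Qed.

(** The event is phrased so as to contain the runs of infinite cost; these are exactly the
    intersection over n, a null set. *)
Lemma cost_tight (e : R) : 0 < e ->
  {ae Prob Q, forall w, cost Q f w <> None} -> exists n : nat,
  (Prob Q [set w | forall k, cost Q f w = Some k -> (n < k)%N] <= e%:E)%E.
Proof.
move=> e0 fin; apply: prob_vanishing => // [n|n w /= h k /h|].
- exact: (measurable_cost minfo [set c | forall k, c = Some k -> (n < k)%N]).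
- exact: ltnW.
- apply: negligibleS fin => w /= h ncost.
  case fw : (cost Q f w) ncost => [k|]// _.
  by have := h k I k fw; rewrite ltnn.
Qed.

(** A counterpart of Jensen's inequality for costs that are only almost surely finite: the integral
    is restricted to runs of cost at most [n]. *)
Lemma miss_power_ge (t e : R) (n : nat) : 0 <= t <= 1 ->
  (Prob Q [set w | forall k, cost Q f w = Some k -> (n < k)%N] <= e%:E)%E ->
  (((1 - t) ^+ n * (1 - e))%:E <=
    \int[Prob Q]_w (miss_power t (cost Q f w))%:E)%E.
Proof.
move=> t01; set F := [set w | _] => Fe.
have mF : measurable F.
  exact: (measurable_cost minfo [set c | forall k, c = Some k -> (n < k)%N]).
apply: (@le_trans _ _ (\int[Prob Q]_w ((1 - t) ^+ n * \1_(~` F) w)%:E)%E).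
  under eq_integral do rewrite EFinM.
  rewrite ge0_integralZl_EFin//; last 2 first.
  - exact/measurable_EFinP/measurable_indic/measurableC.
  - by rewrite exprn_ge0; lra.
  rewrite integral_indic ?setIT//; last exact: measurableC.
  rewrite EFinM lee_wpmul2l ?lee_fin ?exprn_ge0//; first by lra.
  rewrite [leRHS](probability_setC _ mF) EFinB; exact: leeB.
apply: ge0_le_integral => //.
- by move=> w _; rewrite lee_fin mulr_ge0 ?exprn_ge0//; lra.
- apply/measurable_EFinP/measurable_funM => //; apply: measurable_indic.
  exact: measurableC.
- exact/measurable_EFinP/measurable_miss_power.
- move=> w _; rewrite lee_fin indicE in_setC.
  have [wF|wF] := boolP (w \in F); first by rewrite mulr0 miss_power_ge0.
  rewrite mulr1; move: wF; rewrite notin_setE /F/= => /existsNP[k].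
  case/not_implyP => -> /negP; rewrite -leqNgt => kn /=.
  by rewrite ler_wiXn2l//; lra.
Qed.

Lemma measurable_success (c e : R) :
  measurable [set w | `|result Q f w - c| <= e].
Proof.
rewrite -[X in measurable X]setTI.
apply: (measurable_fun_ler (f := fun w => `|result Q f w - c|)
  (g := fun=> e)) => //.
apply: measurableT_comp => //; apply: measurable_funB => //.
exact: measurable_result.
Qed.

Lemma failure_le (c e delta : R) :
  ((1 - delta)%:E <= Prob Q [set w | `|result Q f w - c| <= e]%R)%E ->
  (Prob Q (~` [set w | `|result Q f w - c| <= e]%R) <= delta%:E)%E.
Proof.
move=> h; have mS := measurable_success c e.
rewrite (probability_setC _ mS).
have fS := fin_num_measure (Prob Q) _ mS.
move: h; rewrite -(fineK fS) !lee_fin => h; lra.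
Qed.

End lower_bounds.

Section missed_sets.
Context (R : realType) (d : measure_display) (G : measurableType d).
Variable pi : probability G R.
Variables (Q : randomized_algorithm R G) (f : G -> R).
Hypothesis minfo : measurable_fun setT (information Q f).
Implicit Types (A : set G) (g : G -> R).

Definition succeeds g (eps delta : R) :=
  measurable_fun setT (information Q g) /\
  ((1 - delta)%:E <=
     Prob Q [set w | `|result Q g w - INT pi g| <= eps]%R)%E.

Lemma add_bump_off A (c : R) x : ~ A x -> (f \+ (fun x => c * \1_A x)) x = f x.
Proof. by move=> Ax; rewrite /= indicE memNset// mulr0 addr0. Qed.

(** A missed run has the same output for [f] and [g], which cannot be within [eps] of two integrals
    more than 2 eps apart. So it fails for one of the two functions. *)
Lemma missed_near g A eps delta : measurable A ->
  (forall x, ~ A x -> g x = f x) -> 2 * eps < `|INT pi g - INT pi f| ->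
  succeeds f eps delta -> succeeds g eps delta ->
  (Prob Q (missed f A) <= (2 * delta)%:E)%E.
Proof.
move=> mA fg sep [_ fS] [mg gS].
have mm := measurable_missed minfo mA.
have mF := measurable_success minfo (INT pi f) eps.
have mG := measurable_success mg (INT pi g) eps.
have -> : 2 * delta = delta + delta by ring.
rewrite EFinD; apply: le_trans (leeD (failure_le minfo fS) (failure_le mg gS)).
apply: (@le_trans _ _ (Prob Q (~` [set w | `|result Q f w - INT pi f| <= eps]%R
    `|` ~` [set w | `|result Q g w - INT pi g| <= eps]%R))); last first.
  by apply: measureU2; exact: measurableC.
apply: le_measure; rewrite ?inE//.
  by apply: measurableU; exact: measurableC.
move=> w /(missed_information fg)/eq_result eqr.
rewrite -setCI => -[/=]; rewrite eqr => h1 h2.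
move: sep; rewrite ltNge => /negP; apply.
have -> : INT pi g - INT pi f =
    (result Q f w - INT pi f) - (result Q f w - INT pi g) by ring.
by rewrite (le_trans (ler_normB _ _))//; lra.
Qed.

(* Bumps of unbounded height make the two outputs incompatible outside an event
   of vanishing probability, so no factor 2 is lost in [delta]. *)
Lemma missed_far q A c0 eps delta : (1 <= q)%E -> f \in Lfun pi q ->
  measurable A -> 0 < fine (pi A) ->
  (forall c, c0 <= c -> succeeds (f \+ (fun x => c * \1_A x)) eps delta) ->
  (Prob Q (missed f A) <= delta%:E)%E.
Proof.
move=> q1 fq mA A0 gS; apply/lee_addgt0Pr => e e0.
have mX : measurable_fun setT (fun w => result Q f w - INT pi f).
  by apply: measurable_funB => //; exact: measurable_result.
have [n Xn] := prob_tight (Prob Q) e0 mX.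
have mXn : measurable [set w | n%:R < `|result Q f w - INT pi f|]%R.
  rewrite -[X in measurable X]setTI.
  apply: (measurable_fun_ltr (f := fun=> n%:R)
    (g := fun w => `|result Q f w - INT pi f|)) => //.
  exact: measurableT_comp.
(* This height moves the integral by more than n + eps, so an output within [n] of the integral of
   [f] is wrong for the bumped function. *)
pose c := Num.max c0 ((n%:R + eps + 1) / fine (pi A)).
have [mg gSc] : succeeds (f \+ (fun x => c * \1_A x)) eps delta.
  by apply: gS; rewrite le_max lexx.
set g := f \+ _ in mg gSc.
have gE : INT pi g = INT pi f + c * fine (pi A).
  rewrite /g (INTD q1 fq (LfunZ c q1 (Lfun_indic pi q1 mA))).
  by rewrite (INTZ c q1 (Lfun_indic pi q1 mA)) INT_indic.
have mG := measurable_success mg (INT pi g) eps.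
apply: le_trans (leeD (failure_le mg gSc) Xn).
apply: (@le_trans _ _ (Prob Q (~` [set w | `|result Q g w - INT pi g| <= eps]%R
    `|` [set w | n%:R < `|result Q f w - INT pi f|]%R))); last first.
  by apply: measureU2 => //; exact: measurableC.
apply: le_measure; rewrite ?inE//.
- exact: measurable_missed.
- by apply: measurableU => //; exact: measurableC.
move=> w /(missed_information (@add_bump_off A c))/eq_result eqr.
have [|h] := boolP (`|result Q g w - INT pi g| <= eps); last first.
  by left; exact/negP.
rewrite eqr gE => h; right => /=.
have cA : n%:R + eps + 1 <= c * fine (pi A).
  by rewrite -ler_pdivrMr// le_max lexx orbT.
have := ler_normB (result Q f w - INT pi f)
  (result Q f w - (INT pi f + c * fine (pi A))).
have -> : result Q f w - INT pi f -
    (result Q f w - (INT pi f + c * fine (pi A))) = c * fine (pi A) by ring.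
have := ler_norm (c * fine (pi A)); lra.
Qed.

End missed_sets.

(** * Unsolvability, expected error and the fixed cost *)

Section real_estimates.
Context (R : realType).
Implicit Types (t K : R).

Lemma bernoulli_inequality t n : 0 <= t <= 1 -> 1 - n%:R * t <= (1 - t) ^+ n.
Proof.
move=> /andP[t0 t1]; elim: n => [|n IH]; first by rewrite mul0r subr0 expr0.
have n0 : 0 <= n%:R :> R by [].
rewrite exprS -natr1; apply: le_trans (ler_wpM2l _ IH); last by lra.
by nra.
Qed.

(** By concavity ln (1 - t) lies above its chord between t = 0 and t = 1/2. *)
Lemma ln_chord t : 0 <= t <= 2^-1 -> ln (1 - t)^-1 <= 2 * ln 2 * t.
Proof.
move=> /andP[t0 th].
have s0 : 0 <= 2 * t by lra.
have s1 : 2 * t <= 1 by lra.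
have := concave_ln (Itv01 s0 s1) (ltac:(lra) : (0 < 2^-1 :> R)) ltr01.
rewrite !convRE/= ln1 mulr0 addr0 /unstable.onem lnV ?posrE// => h.
rewrite lnV ?posrE; last by lra.
have e : 2 * t * 2^-1 + (1 - 2 * t) * 1 = 1 - t by field.
by rewrite e in h; lra.
Qed.

(* A centered bump on a set of measure close to [1/2] has almost constant
   modulus, so its norm ratio is close to [1 < K]. *)
Lemma near_half K : 1 < K -> exists eta : R,
  [/\ 0 < eta, eta < 2^-1 & 1 - (2^-1 - eta) < K * (2^-1 - eta)].
Proof.
move=> K1; exists ((K - 1) / (4 * (K + 1))).
have K2 : 0 < 4 * (K + 1) by lra.
have e1 : (K - 1) / (4 * (K + 1)) * (4 * (K + 1)) = K - 1.
  by rewrite divfK// gt_eqF.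
split; first by rewrite divr_gt0//; lra.
  by rewrite ltr_pdivrMr//; lra.
by nra.
Qed.

End real_estimates.

Section solvability_and_fixed_cost.
Context (R : realType) (d : measure_display) (G : measurableType d).
Variable pi : probability G R.
Hypothesis equi : equipartitionable pi.
Implicit Types (Q : randomized_algorithm R G) (p K : R) (q : \bar R).

Lemma succeeds_in Q eps delta F f : algorithm_on Q F ->
  approximating pi Q eps delta F -> F f -> succeeds pi Q f eps delta.
Proof. by move=> alg app Ff; split; [exact: (alg _ Ff).1|exact: app]. Qed.

Lemma Lfun0 q : (1 <= q)%E -> (cst 0 : G -> R) \in Lfun pi q.
Proof.
by move=> q1; apply: (@Lfun_bounded _ _ _ _ _ _ 0) => // x; rewrite normr0.
Qed.

Lemma not_solvable_Lclass q : (1 <= q)%E -> ~ solvable pi (Lclass pi q).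
Proof.
move=> q1 /(_ 1 4^-1 ltr01)[|Q [alg app]].
  by apply/andP; split; lra.
have L0 := Lfun0 q1.
have [m0 fin0] := alg _ L0.
have [n Fn] := cost_tight m0 (e := 4^-1) ltac:(lra) fin0.
(* With this t, (1 - t)^n >= 1 - n t > 1/2, so runs of cost at most n, of probability at least 3/4,
   force a miss probability above 3/8, against the bound 1/4. *)
pose t : R := (2 * n.+1%:R)^-1.
have n1 : 0 < 2 * n.+1%:R :> R by rewrite mulr_gt0.
have tE : n.+1%:R * t = 2^-1.
  by rewrite /t invfM mulrCA mulfV ?mulr1// pnatr_eq0.
have t0 : 0 < t by rewrite invr_gt0.
have n0 : 1 <= n.+1%:R :> R by rewrite ler1n.
have t01 : 0 <= t <= 1 by apply/andP; split; nra.
have : (\int[Prob Q]_w (miss_power t (cost Q (cst 0) w))%:E <= (4^-1)%:E)%E.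
  apply: (detection equi m0 t01 (eta := t / 2)) => [||A mA At]; [lra|lra|].
  apply: (@missed_far _ _ _ pi _ _ m0 q _ 0 1) => //.
    by move: At; rewrite ltr_norml => /andP[]; lra.
  move=> c _; apply: succeeds_in alg app _.
  exact: (LfunD q1 L0 (LfunZ c q1 (Lfun_indic pi q1 mA))).
move/(le_trans (miss_power_ge m0 t01 Fn)); rewrite lee_fin.
have := bernoulli_inequality n t01.
rewrite -natr1 in tE; move: ((1 - t) ^+ n) => x; nra.
Qed.

Lemma cone_class0 p q K : 1 <= p -> (p%:E < q)%E -> 0 < K ->
  cone_class pi p%:E q K (cst 0).
Proof.
move=> p1 pq K0; have q1 : (1 <= q)%E by rewrite (le_trans _ (ltW pq)).
split; first exact: Lfun0.
have -> : centered_norm pi q (cst 0) = 0%E.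
  rewrite /centered_norm INT_cst.
  rewrite [X in Lnorm _ _ X](_ : _ = cst 0%E); last first.
    by apply/funext => x /=; rewrite subr0.
  by rewrite Lnorm0// gt_eqF// (lt_le_trans _ q1).
by rewrite mule_ge0 ?Lnorm_ge0// lee_fin ltW.
Qed.

(** No success probability is assumed, so [detection] is used in reverse: some set of measure near
    1/2 is missed with probability above a fixed [rho]. On half of that probability the output stays
    bounded, while bumps on this set have unbounded integrals. *)
Lemma infinite_expected_error p q K Q : 1 <= p -> (p%:E < q)%E -> 1 < K ->
  algorithm_on Q (cone_class pi p%:E q K) ->
  ereal_sup [set ('E_(Prob Q)[(fun w => `|result Q f w - INT pi f|)%R])%E
            | f in cone_class pi p%:E q K] = +oo%E.
Proof.
move=> p1 pq K1 alg; have K0 : 0 < K by lra.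
have q1 : (1 <= q)%E by rewrite (le_trans _ (ltW pq)).
have L0 := Lfun0 q1.
have [m0 fin0] := alg _ (cone_class0 p1 pq K0).
have [n Fn] := cost_tight m0 (e := 4^-1) ltac:(lra) fin0.
have h01 : 0 <= (2^-1 : R) <= 1 by apply/andP; split; lra.
have [eta [eta0 etah etaK]] := near_half K1.
(* Below the lower bound (1/2)^n 3/4 of [miss_power_ge], so not every admissible set can be missed
   with probability at most [rho]. *)
pose rho : R := (1 - 2^-1) ^+ n / 2.
have rho0 : 0 < rho by rewrite divr_gt0// exprn_gt0//; lra.
have [A [mA [Ah Arho]]] : exists A, measurable A /\
    (`|fine (pi A) - 2^-1| < eta /\ (rho%:E < Prob Q (missed (cst 0%R) A))%E).
  apply/not_existsP => h.
  have := detection equi m0 h01 eta0 (ltW rho0).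
  have small A : measurable A -> `|fine (pi A) - 2^-1| < eta ->
      (Prob Q (missed (cst 0%R) A) <= rho%:E)%E.
    move=> mA Ah; rewrite leNgt; apply/negP => Arho.
    by apply: (h A).
  move=> /(_ small)/(le_trans (miss_power_ge m0 h01 Fn)).
  have : 0 < (1 - 2^-1 : R) ^+ n by rewrite exprn_gt0//; lra.
  by rewrite lee_fin /rho; lra.
have mX := measurable_result m0.
have [m Xm] := prob_tight (Prob Q) (e := rho / 2) ltac:(lra) mX.
pose E := missed (Q := Q) (cst 0) A `&` [set w | `|result Q (cst 0) w| <= m%:R].
have mm := measurable_missed m0 mA.
have mXm : measurable [set w | m%:R < `|result Q (cst 0) w|]%R.
  rewrite -[X in measurable X]setTI.
  apply: (measurable_fun_ltr (f := fun=> m%:R)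
    (g := fun w => `|result Q (cst 0) w|)) => //.
  exact: measurableT_comp.
have mE : measurable E.
  apply: measurableI => //; rewrite (_ : [set w | _] =
    ~` [set w | m%:R < `|result Q (cst 0) w|]%R); first exact: measurableC.
  by apply/seteqP; split => w /=; [rewrite leNgt => /negP|
    move=> /negP; rewrite -leNgt].
have fE := fin_num_measure (Prob Q) _ mE.
have PE : rho / 2 <= fine (Prob Q E).
  have : (rho%:E <= Prob Q E + (rho / 2)%:E)%E.
    apply: le_trans (leeD2l _ Xm); apply: le_trans (ltW Arho) _.
    apply: le_trans (measureU2 _ mE mXm).
    apply: le_measure; rewrite ?inE//; first exact: measurableU.
    move=> w Aw.
    by have [h|h] := leP `|result Q (cst 0) w| m%:R; [left|right].
  by rewrite -(fineK fE) -EFinD lee_fin; lra.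
have a0 : 0 < fine (pi A) by move: Ah; rewrite ltr_norml => /andP[]; lra.
have [c0 [c00 inC]] : exists c0, 0 < c0 /\ forall c, c0 <= c ->
    cone_class pi p%:E q K (cst 0 \+ (fun x => c * \1_A x)).
  apply: cone_ray => //; first exact: Lfun_indic.
  apply: (@cone_indic_half _ _ _ _ _ _ _ (2^-1 - eta)) => //; last by lra.
  by move: Ah; rewrite ltr_norml => /andP[? ?]; apply/andP; split; lra.
apply/eqyP => B B0.
(* The error is then at least 2 B / rho on an event of probability at least rho / 2, hence at least
   [B] in expectation. *)
pose c := Num.max c0 ((m%:R + 2 * B / rho) / fine (pi A)).
have cC : cone_class pi p%:E q K (cst 0 \+ (fun x => c * \1_A x)).
  by apply: inC; rewrite le_max lexx.
apply: le_ereal_sup_tmp; set g := _ \+ _ in cC.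
eexists; first by exists g; [exact: cC|].
have [mg _] := alg _ cC.
have gE : INT pi g = c * fine (pi A).
  rewrite /g (INTD q1 L0 (LfunZ c q1 (Lfun_indic pi q1 mA))) INT_cst add0r.
  by rewrite (INTZ c q1 (Lfun_indic pi q1 mA)) INT_indic.
have cA : m%:R + 2 * B / rho <= c * fine (pi A).
  by rewrite -ler_pdivrMr// le_max lexx orbT.
have B2 : 0 < 2 * B / rho by rewrite divr_gt0//; lra.
rewrite unlock; apply: (@le_trans _ _
    (\int[Prob Q]_w ((2 * B / rho) * \1_E w)%:E)%E).
  under eq_integral do rewrite EFinM.
  rewrite ge0_integralZl_EFin ?(ltW B2)//; last first.
    exact/measurable_EFinP/measurable_indic.
  rewrite integral_indic// setIT -[X in (_ <= _ * X)%E](fineK fE) -EFinM.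
  rewrite lee_fin.
  by rewrite mulrAC ler_pdivlMr//; nra.
apply: ge0_le_integral => //.
- by move=> w _; rewrite lee_fin mulr_ge0// ltW.
- exact/measurable_EFinP/measurable_funM/measurable_indic.
- apply/measurable_EFinP; apply: measurableT_comp => //.
  by apply: measurable_funB => //; exact: measurable_result.
move=> w _; rewrite lee_fin gE indicE.
have [/set_mem[wm wX]|_] := boolP (w \in E); last by rewrite mulr0.
have off := @add_bump_off _ _ _ (cst 0) A c.
rewrite mulr1 /g (eq_result (missed_information off wm)).
move: wX => /=; rewrite ler_norml => /andP[_ wX].
by rewrite distrC (le_trans _ (ler_norm _))//; lra.
Qed.

Lemma cone_mean_cost_ge p q K Q eps delta f t eta :
  1 <= p -> (p%:E < q)%E -> 1 < K ->
  0 < delta < 1 -> 0 < t < 1 -> 0 < eta <= t ->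
  (forall A, measurable A -> `|fine (pi A) - t| < eta ->
    (centered_norm pi q \1_A < K%:E * centered_norm pi p%:E \1_A)%E) ->
  algorithm_on Q (cone_class pi p%:E q K) ->
  approximating pi Q eps delta (cone_class pi p%:E q K) ->
  cone_class pi p%:E q K f ->
  ((ln delta^-1 / ln (1 - t)^-1)%:E <= mean_cost Q f)%E.
Proof.
move=> p1 pq K1 /andP[d0 d1] t01 /andP[eta0 etat] indicK alg app fC.
have q1 : (1 <= q)%E by rewrite (le_trans _ (ltW pq)).
have [mf _] := alg _ fC.
have t01' : 0 <= t <= 1 by move: t01 => /andP[? ?]; apply/andP; split; lra.
apply: mean_cost_ge => //; apply: (detection equi mf t01' eta0 (ltW d0)).
move=> A mA At.
have [c0 [_ inC]] := cone_ray p1 pq (lt_trans ltr01 K1) fC.1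
  (Lfun_indic pi q1 mA) (indicK A mA At).
apply: (@missed_far _ _ _ pi _ _ mf q A c0 eps) => //; first exact: fC.1.
  by move: At; rewrite ltr_norml => /andP[]; lra.
by move=> c /inC; exact: succeeds_in alg app.
Qed.

Lemma complexity_ge cost_of eps delta F (b : \bar R) :
  (forall Q, algorithm_on Q F -> approximating pi Q eps delta F ->
    (b <= cost_of Q F)%E) ->
  (b <= complexity pi cost_of eps delta F)%E.
Proof.
move=> h; apply: le_ereal_inf_tmp => _ /= [n [_ [Q [alg app Qn]]] <-].
exact: le_trans (h Q alg app) Qn.
Qed.

(** A high bump can be added to any member of the cone, so the cost bound holds for every input and
    survives the infimum over inputs. *)
Lemma fix_complexity p q K eps delta : 1 <= p -> (p%:E < q)%E -> 1 < K ->
  0 < eps -> 0 < delta < 1 ->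
  (((2 * ln 2)^-1 * K `^ cone_exponent p q * ln delta^-1)%:E <=
     complexity_fix pi eps delta (cone_class pi p%:E q K))%E.
Proof.
move=> p1 pq K1 eps0 d01; apply: complexity_ge => Q alg app.
apply: le_ereal_inf_tmp => _ /= [f fC <-].
have K0 : 0 < K by lra.
have ln2 : 0 < ln 2 :> R by rewrite ln_gt0// ltr1n.
have lnd : 0 < ln delta^-1 by rewrite ln_gt0// invf_gt1; lra.
set r := cone_exponent p q.
have Kr0 : 0 < K `^ r by exact: powR_gt0.
have half_range A (t eta : R) : `|fine (pi A) - t| < eta ->
    t - eta < fine (pi A) < t + eta.
  by rewrite ltr_norml => /andP[? ?]; apply/andP; split; lra.
(* If K^r <= 2, no t lies strictly between K^(-r) and 1/2. Then t = 1/2 is admissible by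
   [near_half], and its bound ln(1/delta)/ln 2 is enough since K^r / 2 <= 1. *)
have [Kr2|Kr2] := leP (K `^ r) 2.
  have [eta [eta0 etah etaK]] := near_half K1.
  apply: (@le_trans _ _ (ln delta^-1 / ln (1 - 2^-1)^-1)%:E).
    have -> : (1 - 2^-1)^-1 = 2 :> R by field.
    rewrite lee_fin mulrC ler_wpM2l ?(ltW lnd)// invfM mulrAC.
    by rewrite ler_piMl ?invr_ge0 ?(ltW ln2)//; lra.
  apply: (@cone_mean_cost_ge p q K Q eps delta f _ eta) => //.
  - by apply/andP; split; lra.
  - by apply/andP; split; lra.
  - move=> A mA /half_range/andP[? ?].
    apply: (@cone_indic_half _ _ _ _ _ _ _ (2^-1 - eta)) => //; last by lra.
    by apply/andP; split; lra.
(* Otherwise every t of this open interval is admissible, with a window reaching the nearer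
   endpoint; the value t = K^(-r) is only approached. *)
have below t : (K `^ r)^-1 < t < 2^-1 ->
    ((ln delta^-1 / (2 * ln 2) / t)%:E <= mean_cost Q f)%E.
  move=> /andP[Kt t2]; have t0 : 0 < t by rewrite (lt_trans _ Kt)// invr_gt0.
  have lt0 : 0 < ln (1 - t)^-1 by rewrite ln_gt0// invf_gt1; lra.
  apply: (@le_trans _ _ (ln delta^-1 / ln (1 - t)^-1)%:E).
    rewrite lee_fin -mulrA -invfM ler_pM2l// lef_pV2 ?posrE ?mulr_gt0//.
    by apply: ln_chord; apply/andP; split; lra.
  pose eta := Num.min (t - (K `^ r)^-1) (2^-1 - t).
  have eta1 : eta <= t - (K `^ r)^-1 by rewrite ge_min lexx.
  have eta2 : eta <= 2^-1 - t by rewrite ge_min lexx orbT.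
  have ik : 0 < (K `^ r)^-1 by rewrite invr_gt0.
  apply: (@cone_mean_cost_ge p q K Q eps delta f _ eta) => //.
  - by apply/andP; split; lra.
  - by apply/andP; split; [rewrite lt_min; apply/andP; split; lra|lra].
  - move=> A mA /half_range/andP[? ?]; apply: cone_indic => //.
    by rewrite powRN -/r; apply/andP; split; lra.
case E : (mean_cost Q f) below => [B| |] below; last 2 first.
- exact: leey.
- have : (0 <= mean_cost Q f)%E.
    by apply: integral_ge0 => w _; exact: enat_ereal_ge0.
  by rewrite E.
set C := ln delta^-1 / (2 * ln 2) in below.
have C0 : 0 < C by rewrite divr_gt0// mulr_gt0.
have -> : (2 * ln 2)^-1 * K `^ r * ln delta^-1 = C * K `^ r by rewrite /C; ring.
rewrite lee_fin leNgt; apply/negP => BC.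
have iK : (K `^ r)^-1 < 2^-1 by rewrite ltf_pV2 ?posrE.
have iK0 : 0 < (K `^ r)^-1 by rewrite invr_gt0.
have B0 : 0 < B.
  have := below (((K `^ r)^-1 + 2^-1) / 2); rewrite lee_fin => /(_ _) h.
  have : 0 < C / (((K `^ r)^-1 + 2^-1) / 2) by rewrite divr_gt0//; lra.
  by move/lt_le_trans; apply; apply: h; apply/andP; split; lra.
have BCK : (K `^ r)^-1 < C / B.
  by rewrite ltr_pdivlMr// mulrC -ltr_pdivlMr// invrK.
(* A mean cost [B] below C K^r leaves room between K^(-r) and C / B; the midpoint of K^(-r) and [u]
   is an admissible t that violates [below]. *)
pose u := Num.min (C / B) 2^-1.
have uK : (K `^ r)^-1 < u by rewrite lt_min BCK.
have u1 : u <= C / B by rewrite ge_min lexx.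
have u2 : u <= 2^-1 by rewrite ge_min lexx orbT.
have := below (((K `^ r)^-1 + u) / 2); rewrite lee_fin.
have v0 : 0 < ((K `^ r)^-1 + u) / 2 by lra.
rewrite ler_pdivrMr// => h.
have {h} : C <= B * (((K `^ r)^-1 + u) / 2) by apply: h; apply/andP; split; lra.
rewrite leNgt => /negP; apply; rewrite mulrC -ltr_pdivlMr//; lra.
Qed.

End solvability_and_fixed_cost.

(** * Adaptive testing and the worst-case cost *)

Section adaptive_testing.
Context (R : realType) (d : measure_display) (G : measurableType d).
Variables (Q : randomized_algorithm R G) (T : finType) (idx : G -> T).
Variable F : G -> bool -> R.
Implicit Types (s : {ffun T -> bool}) (w : Omega Q).

(* [F] itself may vary inside a cell: only the hidden bit is constant there. *)
Definition coded s : G -> R := fun x => F x (s (idx x)).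

Lemma coded_information s s' w :
  (forall j, j \in hits idx (coded s) w -> s' j = s j) ->
  information Q (coded s') w = information Q (coded s) w.
Proof.
move=> ss'; apply: eq_information => i vi; congr F; apply: ss'.
by apply/hitsP; exists i.
Qed.

(** Bits of cells that are not hit never enter the run, so changing them preserves the information
    and with it all nodes and the stopping time. *)
Lemma hits_self_determined w :
  self_determined (fun s => hits idx (coded s) w).
Proof.
move=> s s' /coded_information eqi; apply/setP => j; apply/hitsP/hitsP.
all: move=> [i vi ij]; exists i; first by move: vi; rewrite /visited /cost eqi.
all: by move: ij; rewrite /sample_point eqi.
Qed.

Hypothesis minfo : forall s, measurable_fun setT (information Q (coded s)).

Lemma integral_weighted_sum (c : {ffun T -> bool} -> R)
    (h : {ffun T -> bool} -> Omega Q -> \bar R) :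
  (forall s, 0 <= c s) -> (forall s w, (0 <= h s w)%E) ->
  (forall s, measurable_fun setT (h s)) ->
  (\int[Prob Q]_w (\sum_s (c s)%:E * h s w) =
   \sum_s (c s)%:E * \int[Prob Q]_w h s w)%E.
Proof.
move=> c0 h0 mh; rewrite ge0_integral_sum//; last 2 first.
- by move=> s; apply: measurable_funeM.
- by move=> s w _; rewrite mule_ge0 ?lee_fin.
by apply: eq_bigr => s _; rewrite ge0_integralZl_EFin.
Qed.

Lemma measurable_positive s : measurable [set w | 0 < result Q (coded s) w].
Proof.
rewrite -[X in measurable X]setTI.
apply: (measurable_fun_ltr (f := fun=> 0) (g := result Q (coded s))) => //.
exact: measurable_result.
Qed.

(** For fixed omega, [testing_inequality] is applied to the cells hit and to the decision
    [0 < result]. Being linear in all terms it can be integrated; the number of cells hit is then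
    bounded by the cost. *)
Lemma adaptive_testing (th l : R) : 0 < th < 1 -> 0 <= l ->
  ((1 + l - expR (- l))%:E <=
    \sum_s (log_odds th * th * bernw ((1 + th) / 2) s)%:E *
      mean_cost Q (coded s) +
    \sum_s (2 * l * bernw ((1 + th) / 2) s)%:E *
      Prob Q (~` [set w | 0 < result Q (coded s) w]%R) +
    \sum_s ((expR l - expR (- l)) * bernw ((1 - th) / 2) s)%:E *
      Prob Q [set w | 0 < result Q (coded s) w]%R)%E.
Proof.
move=> th01 l0; have /andP[th0 th1] := th01.
set t := (1 + th) / 2; set t' := (1 - th) / 2.
have t01 : 0 <= t <= 1 by rewrite /t; apply/andP; split; lra.
have t01' : 0 <= t' <= 1 by rewrite /t'; apply/andP; split; lra.
have lo0 : 0 <= log_odds th.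
  by rewrite ln_ge0// ler_pdivlMr; lra.
have e0 : 0 <= expR l - expR (- l) by rewrite subr_ge0 ler_expR; lra.
have mP := measurable_positive.
have mPC s : measurable (~` [set w | 0 < result Q (coded s) w]).
  exact: measurableC.
pose c1 s := log_odds th * th * bernw t s.
pose c2 s := 2 * l * bernw t s.
pose c3 s := (expR l - expR (- l)) * bernw t' s.
have c10 s : 0 <= c1 s by rewrite !mulr_ge0 ?bernw_ge0// ltW.
have c20 s : 0 <= c2 s by rewrite !mulr_ge0 ?bernw_ge0.
have c30 s : 0 <= c3 s by rewrite !mulr_ge0 ?bernw_ge0.
pose h1 s w := enat_ereal R (cost Q (coded s) w).
pose h2 s w := ((\1_(~` [set w | 0 < result Q (coded s) w]) w)%:E : \bar R).
pose h3 s w := ((\1_[set w | 0 < result Q (coded s) w] w)%:E : \bar R).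
have h10 s w : (0 <= h1 s w)%E by exact: enat_ereal_ge0.
have h20 s w : (0 <= h2 s w)%E by rewrite lee_fin.
have h30 s w : (0 <= h3 s w)%E by rewrite lee_fin.
have mh1 s : measurable_fun setT (h1 s) by exact: measurable_enat_cost.
have mh2 s : measurable_fun setT (h2 s).
  exact/measurable_EFinP/measurable_indic.
have mh3 s : measurable_fun setT (h3 s).
  exact/measurable_EFinP/measurable_indic.
have i2 s : (\int[Prob Q]_w h2 s w =
    Prob Q (~` [set w | 0 < result Q (coded s) w]%R))%E.
  by rewrite integral_indic// setIT.
have i3 s : (\int[Prob Q]_w h3 s w =
    Prob Q [set w | 0 < result Q (coded s) w]%R)%E.
  by rewrite integral_indic// setIT.
under [X in (_ <= _ + X + _)%E]eq_bigr do rewrite -i2.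
under [X in (_ <= _ + X)%E]eq_bigr do rewrite -i3.
rewrite -[X in (_ <= X + _ + _)%E](integral_weighted_sum c10 h10 mh1).
rewrite -[X in (_ <= _ + X + _)%E](integral_weighted_sum c20 h20 mh2).
rewrite -[X in (_ <= _ + X)%E](integral_weighted_sum c30 h30 mh3).
have sum0 (c : {ffun T -> bool} -> R)
    (h : {ffun T -> bool} -> Omega Q -> \bar R) w :
    (forall s, 0 <= c s) -> (forall s w, (0 <= h s w)%E) ->
    (0 <= \sum_s (c s)%:E * h s w)%E.
  by move=> c0 h0; apply: sume_ge0 => s _; rewrite mule_ge0 ?lee_fin.
have msum (c : {ffun T -> bool} -> R)
    (h : {ffun T -> bool} -> Omega Q -> \bar R) :
    (forall s, measurable_fun setT (h s)) ->
    measurable_fun setT (fun w => \sum_s (c s)%:E * h s w)%E.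
  by move=> mh; apply: emeasurable_sum => s; exact: measurable_funeM.
rewrite -ge0_integralD//; [|by move=> w _; exact: sum0|exact: msum
  |by move=> w _; exact: sum0|exact: msum].
rewrite -ge0_integralD//; [|by move=> w _; rewrite adde_ge0 ?sum0
  |by apply: emeasurable_funD; exact: msum
  |by move=> w _; exact: sum0|exact: msum].
apply: (@le_trans _ _ (\int[Prob Q]_w (cst (1 + l - expR (- l))%:E w))%E).
  by rewrite integral_cst// measure_setT mule1.
apply: ge0_le_integral => //.
- move=> w _; rewrite lee_fin; have : expR (- l) <= 1 by rewrite expR_le1; lra.
  lra.
- by apply: emeasurable_funD; [apply: emeasurable_funD|]; exact: msum.
move=> w _ /=.
have := @testing_inequality R T (fun s => hits idx (coded s) w)
  (fun s => 0 < result Q (coded s) w) th l th01 (@hits_self_determined w).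
have Adet s s' : (forall j, j \in hits idx (coded s) w -> s' j = s j) ->
    (0 < result Q (coded s') w) = (0 < result Q (coded s) w).
  by move=> /coded_information/eq_result ->.
move=> /(_ Adet); rewrite -/t -/t' -lee_fin => /le_trans; apply.
rewrite !EFinD; apply: leeD; first apply: leeD.
- rewrite mulr_sumr -sumEFin; apply: lee_sum => s _.
  rewrite mulrA EFinM; apply: lee_wpmul2l; first by rewrite lee_fin; exact: c10.
  exact: card_hits_ereal.
- rewrite mulr_sumr big_mkcond/= -sumEFin; apply: lee_sum => s _.
  rewrite /h2 -EFinM lee_fin indicE in_setC.
  case: ifPn => h; last by rewrite mulr_ge0.
  by rewrite memNset ?mulr1//=; exact/negP.
- rewrite mulr_sumr big_mkcond/= -sumEFin; apply: lee_sum => s _.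
  rewrite /h3 -EFinM lee_fin indicE.
  case: ifPn => h; last by rewrite mulr_ge0.
  by rewrite mem_set ?mulr1.
Qed.

End adaptive_testing.

(** * Integration errors as testing errors *)

Section testing_bound.
Context (R : realType) (d : measure_display) (G : measurableType d).
Variable pi : probability G R.
Hypothesis equi : equipartitionable pi.

(** Under the biases (1 + th)/2 and (1 - th)/2 a typical configuration has integral near k th and -
    k th, farther than [eps] from 0, so an output of the wrong sign is a failure. Atypical
    configurations contribute at most [e], which is arbitrary. *)
Lemma testing_bound (Q : randomized_algorithm R G) (C : set (G -> R))
    (F : G -> bool -> R) (eps delta th l k n : R) :
  (forall (T : finType) (idx : G -> T) s, partition_index pi idx ->
     C (coded idx F s) /\ INT pi (coded idx F s) = k * (2 * freq R s - 1)) ->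
  0 < k -> 0 <= eps < k * th -> 0 < th < 1 -> 0 <= l -> 0 <= delta ->
  algorithm_on Q C -> approximating pi Q eps delta C ->
  (cost_wor Q C <= n%:E)%E ->
  1 + l - expR (- l) <=
    log_odds th * th * n + (2 * l + (expR l - expR (- l))) * delta.
Proof.
move=> FC k0 /andP[eps0 epsk] th01 l0 d0 alg app Cn.
have /andP[th0 th1] := th01.
set D := 2 * l + (expR l - expR (- l)).
have el : 0 <= expR l - expR (- l) by rewrite subr_ge0 ler_expR; lra.
have D0 : 0 <= D by rewrite addr_ge0 ?mulr_ge0.
apply/ler_addgt0Pr => e e0.
(* A quarter of the slack: k (th - 2 eta) is the midpoint of k th and [eps], still above [eps]. *)
pose eta := (th - eps / k) / 4.
have epsk' : eps / k < th by rewrite ltr_pdivrMr// mulrC.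
have eta0 : 0 < eta by rewrite /eta; lra.
have eD : 0 < e / (D + 1) by rewrite divr_gt0//; lra.
have [N NP] := small_cells eta0 eD.
have T0 : (0 < #|'I_N.+1|)%N by rewrite card_ord.
have [idx idxP] := equipartition_index equi T0.
have mi s : measurable_fun setT (information Q (coded idx F s)).
  exact: (alg _ (FC _ _ _ idxP).1).1.
have := adaptive_testing mi th01 l0.
set t := (1 + th) / 2; set t' := (1 - th) / 2.
have t01 : 0 <= t <= 1 by rewrite /t; apply/andP; split; lra.
have t01' : 0 <= t' <= 1 by rewrite /t'; apply/andP; split; lra.
have lo0 : 0 <= log_odds th by rewrite ln_ge0// ler_pdivlMr; lra.
set S1 := (\sum_s _)%E; set S2 := (\sum_s _)%E; set S3 := (\sum_s _)%E => main.
have mP s := measurable_positive mi s.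
have fail s : (Prob Q (~` [set w |
    `|result Q (coded idx F s) w - INT pi (coded idx F s)| <= eps]%R)
    <= delta%:E)%E.
  by apply: failure_le => //; exact: app _ (FC _ _ _ idxP).1.
have mF s := measurable_success (mi s) (INT pi (coded idx F s)) eps.
have le1 : (S1 <= (log_odds th * th * n)%:E)%E.
  apply: (@le_trans _ _ (\sum_(s : {ffun 'I_N.+1 -> bool})
      (log_odds th * th * bernw t s * n)%:E)%E).
    apply: lee_sum => s _; rewrite [leRHS]EFinM; apply: lee_wpmul2l.
      by rewrite lee_fin !mulr_ge0 ?bernw_ge0// ltW.
    apply: le_trans Cn; apply: ereal_sup_ubound.
    by exists (coded idx F s) => //; exact: (FC _ _ _ idxP).1.
  by rewrite sumEFin lee_fin -mulr_suml -mulr_sumr sum_bernw mulr1.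
have weighted (c u : R) (m : {ffun 'I_N.+1 -> bool} -> \bar R) :
    0 <= c -> 0 <= u <= 1 -> (forall s, (0 <= m s <= 1)%E) ->
    (forall s, `|freq R s - u| < eta -> (m s <= delta%:E)%E) ->
    (\sum_s (c * bernw u s)%:E * m s <= (c * (delta + e / (D + 1)))%:E)%E.
  move=> c0 u01 m01 mu.
  under eq_bigr do rewrite EFinM -muleA.
  rewrite -ge0_sume_distrr; last first.
    move=> s _; rewrite mule_ge0 ?lee_fin ?bernw_ge0//.
    by case/andP: (m01 s).
  rewrite EFinM lee_wpmul2l ?lee_fin//.
  apply: (le_trans (sum_bernw_le u01 eta0 d0 T0 _ mu)) => [s|].
    by case/andP: (m01 s).
  by rewrite lee_fin lerD2l.
have p01 (A : set (Omega Q)) : measurable A -> (0 <= Prob Q A <= 1)%E.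
  by move=> mA; rewrite measure_ge0/=; exact: probability_le1.
have INTE s := (FC _ _ s idxP).2.
have etaE : k * (th - 2 * eta) > eps.
  have -> : k * (th - 2 * eta) = (k * th + eps) / 2.
    by rewrite /eta; field; rewrite gt_eqF.
  by lra.
have le2 : (S2 <= (2 * l * (delta + e / (D + 1)))%:E)%E.
  apply: weighted => // [|s|s]; first by rewrite mulr_ge0.
    exact/p01/measurableC.
  rewrite ltr_norml => /andP[st _]; apply: le_trans (fail s).
  apply: le_measure; rewrite ?inE//; [exact: measurableC..|].
  apply: subsetC => w /=; rewrite INTE ler_norml => /andP[h _].
  have : k * (th - 2 * eta) <= k * (2 * freq R s - 1).
    by rewrite ler_pM2l// /t in st *; lra.
  by lra.
have le3 : (S3 <= ((expR l - expR (- l)) * (delta + e / (D + 1)))%:E)%E.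
  apply: weighted => // s; first exact: p01.
  rewrite ltr_norml => /andP[_ st]; apply: le_trans (fail s).
  apply: le_measure; rewrite ?inE//; [exact: measurableC|].
  move=> w /= pos; rewrite INTE ler_norml => /andP[_ h].
  have : k * (2 * freq R s - 1) <= k * (2 * eta - th).
    by rewrite ler_pM2l// /t' in st *; lra.
  by lra.
move: main => /le_trans/(_ (leeD (leeD le1 le2) le3)).
rewrite -!EFinD lee_fin => /le_trans; apply.
have De : D * (e / (D + 1)) <= e.
  rewrite mulrCA -[leRHS]mulr1 ler_pM2l//.
  by rewrite ler_pdivrMr ?ltr_wpDl// mul1r lerDl.
move: De; set x := e / (D + 1) => De.
have -> : log_odds th * th * n + 2 * l * (delta + x) +
    (expR l - expR (- l)) * (delta + x) =
    log_odds th * th * n + D * delta + D * x by rewrite /D; ring.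
by rewrite lerD2l.
Qed.

End testing_bound.

(** * Spikes on a balanced sign function *)

Section worst_case.
Context (R : realType) (d : measure_display) (G : measurableType d).
Variable pi : probability G R.
Hypothesis equi : equipartitionable pi.
Implicit Types (Q : randomized_algorithm R G) (A B : set G).

Lemma half_set : exists2 B, measurable B & fine (pi B) = 2^-1.
Proof.
have [A [mA _ _ pA]] := equi (ltn0Sn 1).
by exists (A ord0) => //; rewrite pA.
Qed.

Definition signs B : G -> R := fun x => 2 * \1_B x - 1.

Lemma measurable_signs B : measurable B -> measurable_fun setT (signs B).
Proof. by move=> mB; apply: measurable_funB => //; exact: measurable_funM. Qed.

Lemma norm_signs B x : `|signs B x| = 1.
Proof.
rewrite /signs indicE; case: (x \in B) => /=.
  by rewrite ger0_norm; lra.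
by rewrite ler0_norm; lra.
Qed.

Lemma Lfun_signs q B : (1 <= q)%E -> measurable B -> signs B \in Lfun pi q.
Proof.
move=> q1 mB.
apply: (@Lfun_bounded _ _ _ pi q _ 1 q1 (measurable_signs mB)) => x.
by rewrite norm_signs.
Qed.

Lemma INT_signs B : measurable B -> INT pi (signs B) = 2 * fine (pi B) - 1.
Proof.
move=> mB; have i1 : (\1_B : G -> R) \in Lfun pi 1%E by exact: Lfun_indic.
have -> : signs B = (fun x => 2 * \1_B x) \+ cst (- 1) by [].
rewrite (@INTD _ _ _ _ 1%E)//; last 2 first.
- exact: LfunZ.
- by apply: (@Lfun_bounded _ _ _ _ _ _ 1) => // x; rewrite normrN normr1.
by rewrite (INTZ 2 _ i1)// INT_indic// INT_cst.
Qed.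

Definition spike (s h : R) A B : G -> R :=
  (fun x => h * \1_A x) \+ (fun x => s * signs B x).

Lemma INT_spike s h A B : measurable A -> measurable B ->
  fine (pi B) = 2^-1 -> INT pi (spike s h A B) = h * fine (pi A).
Proof.
move=> mA mB piB.
have i1 : (\1_A : G -> R) \in Lfun pi 1%E by exact: Lfun_indic.
have s1 : signs B \in Lfun pi 1%E by exact: Lfun_signs.
rewrite /spike (@INTD _ _ _ _ 1%E)//; [|exact: LfunZ..].
rewrite (INTZ _ _ i1)// (INTZ _ _ s1)// INT_indic// INT_signs// piB.
by rewrite mulfV// subrr mulr0 addr0.
Qed.

(** The sign part has mean 0 and constant modulus s = tau - v, hence norm s in every order. A bump
    of norm at most v gives a q-norm at most s + v = tau and a p-norm at least s - v = tau / K; the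
    last equation determines v. *)
Lemma spike_in_class p q K tau v h A B : 1 <= p -> p < q -> 1 < K -> 0 < tau ->
  v = (1 - K^-1) * tau / 2 ->
  measurable B -> fine (pi B) = 2^-1 -> measurable A -> 0 <= h ->
  (forall r, 1 <= r <= q ->
    (h%:E * centered_norm pi r%:E \1_A <= v%:E)%E) ->
  (cone_class pi p%:E q%:E K `&` ball_class pi q%:E tau)
    (spike (tau - v) h A B).
Proof.
move=> p1 pq K1 tau0 vE mB piB mA h0 hA.
have K0 : 0 < K by exact: lt_trans K1.
have Ki0 : 0 < K^-1 by rewrite invr_gt0.
have Ki1 : K^-1 < 1 by rewrite invf_lt1.
set s := tau - v.
have s0 : 0 < s by rewrite /s vE; nra.
have q1 : 1 <= q by lra.
have iq r : 1 <= r -> (fun x => h * \1_A x) \in Lfun pi r%:E.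
  by move=> r1; apply: LfunZ => //; exact: Lfun_indic.
have sq r : 1 <= r -> (fun x => s * signs B x) \in Lfun pi r%:E.
  by move=> r1; apply: LfunZ => //; exact: Lfun_signs.
have spE : spike s h A B =
  (fun x => h * \1_A x) \+ (fun x => s * signs B x) by [].
have iN r : 1 <= r <= q ->
    (centered_norm pi r%:E (fun x => h * \1_A x)%R <= v%:E)%E.
  move=> r1q; have /andP[r1 rq] := r1q.
  by rewrite centered_normZ ?hA//; exact: Lfun_indic.
have INTs : INT pi (fun x => s * signs B x) = 0.
  rewrite (@INTZ _ _ _ _ 1%E)//; last exact: Lfun_signs.
  by rewrite INT_signs// piB mulfV// subrr mulr0.
have ms : measurable_fun setT
    ((fun x => s * signs B x) \- cst (INT pi (fun x => s * signs B x))).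
  apply: measurable_center; apply: measurable_funM => //.
  exact: measurable_signs.
have ns x : `|((fun x => s * signs B x) \-
    cst (INT pi (fun x => s * signs B x))) x| = s.
  by rewrite /= INTs subr0 normrM norm_signs mulr1 gtr0_norm.
have sN : (centered_norm pi q%:E (fun x => s * signs B x)%R <= s%:E)%E.
  by apply: Lnorm_le_bound => // x; rewrite ns.
have sNp : (s%:E <= centered_norm pi p%:E (fun x => s * signs B x)%R)%E.
  by apply: Lnorm_ge_bound => // [|x]; rewrite ?ns// ltW.
have spq : spike s h A B \in Lfun pi q%:E.
  by rewrite spE; apply: LfunD; [|exact: iq|exact: sq].
have spp : spike s h A B \in Lfun pi p%:E.
  by rewrite spE; apply: LfunD; [|exact: iq|exact: sq].
have le_tau : (centered_norm pi q%:E (spike s h A B) <= tau%:E)%E.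
  have -> : tau = v + s by rewrite /s; ring.
  rewrite spE EFinD; apply: le_trans (centered_normD _ _ _) _ => //;
    [exact: iq|exact: sq|].
  by apply: leeD => //; apply: iN; apply/andP; split.
split; split => //.
apply: le_trans le_tau _.
have := centered_norm_subD p1 (iq _ p1) (sq _ p1); rewrite -spE.
move=> /(le_trans sNp)/le_trans/(_ (leeD2l _ (iN p _))).
have X0 : (0 <= centered_norm pi p%:E (spike s h A B))%E by exact: Lnorm_ge0.
case: (centered_norm pi p%:E (spike s h A B)) X0 => [X| |]// X0 h1; last first.
  by rewrite gt0_muley ?leey// lte_fin; lra.
have {h1} : s <= X + v.
  by rewrite -lee_fin EFinD; apply: h1; apply/andP; split; lra.
rewrite -EFinM lee_fin /s vE => h1.
have KK : K * K^-1 = 1 by rewrite mulfV// gt_eqF//; lra.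
by nra.
Qed.

(** The norm is at most 2 a^(1/r) <= 2 a^(1/q), and 2 a^(1/q) <= rho a is the lower bound on a
    solved for a. *)
Lemma spike_norm_small (r q rho a : R) : 1 <= r -> r <= q -> 0 < rho ->
  (rho / 2) `^ (- (1 + (q - 1)^-1)) < a <= 2^-1 -> 1 < q ->
  bernoulli_moment a r `^ r^-1 <= rho * a.
Proof.
move=> r1 rq rho0 /andP[xa a2] q1.
have a0 : 0 < a by rewrite (le_lt_trans _ xa)// powR_ge0.
have kE : 1 + (q - 1)^-1 = q / (q - 1) by field; lra.
apply: le_trans (bernoulli_moment_le _ r1) _; first by rewrite a0.
have le_q : a `^ r^-1 <= a `^ q^-1.
  by rewrite ger_powR ?a0/=; [|lra|rewrite lef_pV2 ?posrE; lra].
have rho2 : 0 < rho / 2 by lra.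
move: xa; set x := (rho / 2) `^ _ => xa.
have x0 : 0 < x by exact: powR_gt0.
have xE : rho / 2 = x `^ (- ((q - 1) / q)).
  rewrite /x -powRrM kE [X in _ `^ X](_ : _ = 1) ?powRr1//; first by lra.
  by field; apply/andP; split; lra.
have : a `^ (- ((q - 1) / q)) <= rho / 2.
  rewrite xE !powRN lef_pV2 ?posrE ?powR_gt0//.
  rewrite ge0_ler_powR ?nnegrE ?(ltW a0) ?(ltW x0) ?(ltW xa)//.
  by rewrite divr_ge0; lra.
rewrite -(ler_pM2r a0).
have -> : a `^ (- ((q - 1) / q)) * a = a `^ q^-1.
  rewrite -{2}(powRr1 (ltW a0)) -powRD; last by rewrite (gt_eqF a0) implybT.
  by congr (_ `^ _); field; lra.
by nra.
Qed.

(** For small [rho] the threshold of [spike_norm_small] may exceed 1/2; on sets of measure at least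
    1/2 the centered indicator is simply bounded by that measure. *)
Lemma spike_norm_large r (rho : R) A : 1 <= r -> 1 <= rho -> measurable A ->
  2^-1 <= fine (pi A) ->
  (centered_norm pi r%:E \1_A <= (rho * fine (pi A))%:E)%E.
Proof.
move=> r1 rho1 mA; have /andP[a0 a1] := fine_prob01 pi mA.
set a := fine (pi A) in a0 a1 * => a2.
apply: Lnorm_le_bound => //.
  by apply: measurable_center; exact: measurable_indic.
move=> x /=; rewrite INT_indic// -/a indicE.
have : a <= rho * a by rewrite ler_peMl.
by case: (x \in A) => /=; rewrite ler_norml => ?; apply/andP; split; lra.
Qed.

(** Here (2 delta)^2 <= 4/3 delta: the doubled failure probability of [missed_near] costs a factor 2
    in the logarithm. *)
Lemma ln_delta (delta : R) : 0 < delta < 4^-1 ->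
  ln (4 / 3 * delta)^-1 <= 2 * ln (2 * delta)^-1.
Proof.
move=> /andP[d0 d4]; rewrite [leRHS]mulr_natl -lnXn ?invr_gt0//; last by lra.
rewrite ler_ln ?posrE ?exprn_gt0 ?invr_gt0//; [|lra..].
rewrite exprVn lef_pV2 ?posrE ?exprn_gt0//; [|lra..].
by nra.
Qed.

End worst_case.

Section worst_case_bounds.
Context (R : realType) (d : measure_display) (G : measurableType d).
Variable pi : probability G R.
Hypothesis equi : equipartitionable pi.
Implicit Types (Q : randomized_algorithm R G) (A B : set G).

(* The base is [rho / 4] at [tau = eps], where
   [rho = (1 - 1/K) tau / (6 eps)] is the ratio of the admissible norm of a
   spike to its integral [3 eps]. *)
Definition wor_constant (q : \bar R) (K : R) : R :=
  6^-1 * ((1 - K^-1) / 24) `^ (1 + (fine (min2 q) - 1)^-1).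

Lemma wor_constantE q (K tau eps L : R) : 1 < K -> 0 < tau -> 0 < eps ->
  wor_constant q K * (tau / eps) `^ (1 + (fine (min2 q) - 1)^-1) * L =
  6^-1 * ((1 - K^-1) * tau / 2 / (3 * eps) / 4) `^
    (1 + (fine (min2 q) - 1)^-1) * L.
Proof.
move=> K1 tau0 eps0; have Ki1 : K^-1 < 1 by rewrite invf_lt1// (lt_trans _ K1).
have -> : (1 - K^-1) * tau / 2 / (3 * eps) / 4 = (1 - K^-1) / 24 * (tau / eps).
  by field; rewrite !gt_eqF//; lra.
rewrite /wor_constant [in RHS]powRM ?mulrA//; first by rewrite divr_ge0//; lra.
by rewrite divr_ge0// ltW.
Qed.

Lemma spike_cost Q (p q K tau eps delta t eta : R) :
  1 <= p -> p < q -> 1 < K -> 0 < tau -> 0 < eps -> 0 < delta ->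
  0 < t < 1 -> 0 < eta < t ->
  (forall A r, measurable A -> `|fine (pi A) - t| < eta -> 1 <= r <= q ->
    (centered_norm pi r%:E \1_A <=
     ((1 - K^-1) * tau / 2 / (3 * eps) * fine (pi A))%:E)%E) ->
  algorithm_on Q (cone_class pi p%:E q%:E K `&` ball_class pi q%:E tau) ->
  approximating pi Q eps delta
    (cone_class pi p%:E q%:E K `&` ball_class pi q%:E tau) ->
  ((ln (2 * delta)^-1 / ln (1 - t)^-1)%:E <=
    cost_wor Q (cone_class pi p%:E q%:E K `&` ball_class pi q%:E tau))%E.
Proof.
set C := _ `&` _ => p1 pq K1 tau0 eps0 d0 t01 /andP[eta0 etat] norm_le alg app.
have [B mB piB] := half_set equi.
set v := (1 - K^-1) * tau / 2.
have Ki1 : K^-1 < 1 by rewrite invf_lt1// (lt_trans _ K1).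
have v0 : 0 < v by rewrite /v; nra.
(* Height 0 on the empty set: the bare sign function, written as a spike so that [spike_in_class]
   applies. *)
pose f := spike (tau - v) 0 set0 B.
have fC : C f.
  apply: spike_in_class => // r _.
  by rewrite mul0e lee_fin ltW.
have [mf _] := alg _ fC.
apply: (@le_trans _ _ (mean_cost Q f)); last first.
  by apply: ereal_sup_ubound; exists f.
have t01' : 0 <= t <= 1 by move: t01 => /andP[? ?]; apply/andP; split; lra.
have d2 : 0 < 2 * delta by lra.
apply: mean_cost_ge => //; apply: (detection equi mf t01' eta0 (ltW d2)).
move=> A mA At; have a0 : 0 < fine (pi A).
  by move: At; rewrite ltr_norml => /andP[]; lra.
set a := fine (pi A) in a0 At.
have e3 : 0 < 3 * eps by lra.
(* The bump has integral 3 eps, more than the 2 eps needed for separation; the norm hypothesis says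
   exactly that its norm is at most [v]. *)
pose g := spike (tau - v) (3 * eps / a) A B.
have gC : C g.
  apply: spike_in_class => //; first by rewrite divr_ge0// ltW.
  move=> r r1q; apply: le_trans (lee_wpmul2l _ (norm_le A r mA At r1q)) _.
    by rewrite lee_fin divr_ge0// ltW.
  rewrite -EFinM lee_fin -/v -/a le_eqVlt; apply/orP; left; apply/eqP.
  by field; rewrite !gt_eqF.
apply: (@missed_near _ _ _ pi _ _ mf g A eps delta) => //.
- move=> x Ax; rewrite /g /f /spike /= !indicE in_set0 memNset//.
  by rewrite !mulr0.
- rewrite !INT_spike//.
  by rewrite measure0 mul0r subr0 divfK ?gt_eqF// gtr0_norm; lra.
- exact: succeeds_in alg app fC.
- exact: succeeds_in alg app gC.
Qed.

Lemma ln2_le1 : ln 2 <= 1 :> R.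
Proof. by have := @le_ln1Dx R 1; rewrite -natr1; apply; lra. Qed.

Lemma cost_wor_spike Q (p q K tau eps delta : R) :
  1 <= p -> p < q -> q <= 2 -> 1 < K -> 0 < tau ->
  0 < eps < 6^-1 * (1 - K^-1) * tau -> 0 < delta < 4^-1 ->
  algorithm_on Q (cone_class pi p%:E q%:E K `&` ball_class pi q%:E tau) ->
  approximating pi Q eps delta
    (cone_class pi p%:E q%:E K `&` ball_class pi q%:E tau) ->
  ((6^-1 * ((1 - K^-1) * tau / 2 / (3 * eps) / 4) `^ (1 + (q - 1)^-1) *
     ln (4 / 3 * delta)^-1)%:E <=
    cost_wor Q (cone_class pi p%:E q%:E K `&` ball_class pi q%:E tau))%E.
Proof.
move=> p1 pq q2 K1 tau0 /andP[eps0 eps6] d04 alg app.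
have /andP[d0 d4] := d04.
set rho := (1 - K^-1) * tau / 2 / (3 * eps).
have rho1 : 1 < rho by rewrite ltr_pdivlMr; lra.
set k := 1 + (q - 1)^-1.
have k2 : 2 <= k.
  have : 1 <= (q - 1)^-1 by rewrite invf_ge1; lra.
  by rewrite /k; lra.
have Ld := ln_delta d04.
have L0 : 0 < ln (2 * delta)^-1 by rewrite ln_gt0// invf_gt1; lra.
have L10 : 0 < ln (4 / 3 * delta)^-1 by rewrite ln_gt0// invf_gt1; lra.
have spike_cost' := spike_cost p1 pq K1 tau0 eps0 d0 _ _ _ alg app.
(* For rho >= 4 one has y >= 4, and t = 3/(2y) with window 1/(2y) keeps the measures in (1/y, 2/y),
   within (1/y, 1/2]. The chord bound gives y/3 times the logarithm, and [ln_delta] halves this to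
   the factor 1/6. *)
have [rho4|rho4] := leP 4 rho.
  pose y := (rho / 2) `^ k.
  have y4 : 4 <= y.
    apply: (@le_trans _ _ ((rho / 2) `^ 2)); last by rewrite ler_powR//; lra.
    by rewrite powR_mulrn; [rewrite expr2; nra|lra].
  have y0 : 0 < y by exact: lt_le_trans y4.
  have iy0 : 0 < y^-1 by rewrite invr_gt0.
  have iy4 : y^-1 <= 4^-1 by rewrite lef_pV2 ?posrE.
  apply: (@le_trans _ _ (ln (2 * delta)^-1 / ln (1 - 3 / 2 * y^-1)^-1)%:E).
    rewrite lee_fin.
    have l0 : 0 < ln (1 - 3 / 2 * y^-1)^-1 by rewrite ln_gt0// invf_gt1; lra.
    have lu : ln (1 - 3 / 2 * y^-1)^-1 <= 3 * y^-1.
      apply: le_trans (ln_chord _) _; first by apply/andP; split; lra.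
      by have := ln2_le1; nra.
    apply: (@le_trans _ _ (ln (2 * delta)^-1 / (3 * y^-1))); last first.
      by rewrite ler_pM2l// lef_pV2 ?posrE ?mulr_gt0.
    have -> : ln (2 * delta)^-1 / (3 * y^-1) = 3^-1 * y * ln (2 * delta)^-1.
      by field; lra.
    have : (rho / 4) `^ k <= y.
      by rewrite ge0_ler_powR ?nnegrE//; lra.
    have : 0 <= (rho / 4) `^ k by exact: powR_ge0.
    by move: ((rho / 4) `^ k) => z; nra.
  apply: (spike_cost' _ (y^-1 / 2)).
  - by apply/andP; split; lra.
  - by apply/andP; split; lra.
  move=> A r mA; rewrite ltr_norml => /andP[Al Au] /andP[r1 rq].
  rewrite (centered_norm_indic _ r1)// lee_fin.
  rewrite -/rho; apply: (spike_norm_small r1 rq); [lra| |lra].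
  by rewrite powRN -/k -/y; apply/andP; split; lra.
(* For rho < 4 the base rho / 4 makes the power at most 1, so the fixed t = 3/4, with measures in
   (1/2, 1), is enough. *)
apply: (@le_trans _ _ (ln (2 * delta)^-1 / ln (1 - 3 / 4)^-1)%:E).
  rewrite lee_fin.
  have -> : (1 - 3 / 4)^-1 = 2 ^+ 2 :> R by field.
  rewrite lnXn//; have := ln2_le1.
  have l20 : 0 < ln 2 :> R by rewrite ln_gt0// ltr1n.
  move=> l21; rewrite ler_pdivlMr; last by rewrite mulrn_wgt0.
  have : (rho / 4) `^ k <= 1.
    rewrite [leRHS](_ : 1 = 1 `^ k); last by rewrite powR1.
    by rewrite ge0_ler_powR ?nnegrE//; lra.
  have : 0 <= (rho / 4) `^ k by exact: powR_ge0.
  rewrite -[ln 2 *+ 2]mulr_natr.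
  move: ((rho / 4) `^ k) => z z0 z1.
  have : z * ln (4 / 3 * delta)^-1 <= ln (4 / 3 * delta)^-1.
    exact: (ler_piMl (ltW L10) z1).
  by nra.
apply: (spike_cost' _ 4^-1).
- by apply/andP; split; lra.
- by apply/andP; split; lra.
move=> A r mA; rewrite ltr_norml => /andP[Al Au] /andP[r1 rq].
by rewrite -/rho; apply: spike_norm_large => //; lra.
Qed.

(** * Biased signs on the cells, for q above 2 *)

Definition biased_signs (s k : R) B : G -> bool -> R :=
  fun x b => s * signs R B x + k * (if b then 1 else -1).

Section biased_signs.
Variables (T : finType) (idx : G -> T) (B : set G).
Hypotheses (idxP : partition_index pi idx) (mB : measurable B).

Lemma coded_biased_signs s k b : coded idx (biased_signs s k B) b =
  (fun x => s * signs R B x) \+ (fun x => k * signs R (union_of idx b) x).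
Proof.
apply/funext => x; rewrite /coded /biased_signs /= {3}/signs indicE.
congr (_ + k * _); case bx : (b (idx x)); first by rewrite mem_set//=; ring.
by rewrite memNset /union_of/= ?bx//; ring.
Qed.

Lemma INT_biased_signs s k b : fine (pi B) = 2^-1 ->
  INT pi (coded idx (biased_signs s k B) b) = k * (2 * freq R b - 1).
Proof.
move=> piB; have mA := measurable_union_of idxP b.
have s1 A : measurable A -> signs R A \in Lfun pi 1%E by exact: Lfun_signs.
rewrite coded_biased_signs (@INTD _ _ _ _ 1%E)//;
  [|by apply: LfunZ => //; exact: s1..].
rewrite (@INTZ _ _ _ _ 1%E) ?s1// (@INTZ _ _ _ _ 1%E) ?s1//.
rewrite !INT_signs// piB mulfV// subrr mulr0 add0r.
by rewrite (prob_union_of idxP).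
Qed.

(** The first term has mean 0 and modulus [s]; the second, once centered, is [k] times a difference
    of two numbers in [-1, 1]. A pointwise bound controls all norms at once, infinite q included. *)
Lemma norm_centered_biased_signs s k b x : fine (pi B) = 2^-1 ->
  0 < s -> 0 < k ->
  let f := coded idx (biased_signs s k B) b in
  s - 2 * k <= `|(f \- cst (INT pi f)) x| <= s + 2 * k.
Proof.
move=> piB s0 k0 /=; rewrite INT_biased_signs// coded_biased_signs /=.
have : 0 <= freq R b <= 1.
  have := fine_prob01 pi (measurable_union_of idxP b).
  by rewrite (prob_union_of idxP).
move: (freq R b) => m /andP[m0 m1].
have -> : s * signs R B x + k * signs R (union_of idx b) x - k * (2 * m - 1) =
    s * signs R B x + k * (signs R (union_of idx b) x - (2 * m - 1)) by ring.
set z := k * _.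
have z2 : `|z| <= 2 * k.
  rewrite normrM gtr0_norm// mulrC ler_pM2r// /signs indicE ler_norml.
  by case: (x \in _) => /=; apply/andP; split; lra.
have ss : `|s * signs R B x| = s.
  by rewrite normrM norm_signs mulr1 gtr0_norm.
apply/andP; split.
  by rewrite -{1}ss; have := lerB_normD (s * signs R B x) z; lra.
by rewrite (le_trans (ler_normD _ _))// ss; lra.
Qed.

(** The coefficients solve s + 2 k = tau and s - 2 k = tau / K. *)
Lemma biased_signs_in_class p q K tau b : 1 <= p -> (p%:E < q)%E ->
  1 < K -> 0 < tau -> fine (pi B) = 2^-1 ->
  (cone_class pi p%:E q K `&` ball_class pi 2%:E tau)
    (coded idx
       (biased_signs ((1 + K^-1) * tau / 2) ((1 - K^-1) * tau / 4) B) b).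
Proof.
move=> p1 pq K1 tau0 piB; have q1 : (1 <= q)%E by rewrite (le_trans _ (ltW pq)).
have K0 : 0 < K by rewrite (lt_trans _ K1).
have Ki1 : K^-1 < 1 by rewrite invf_lt1.
have Ki0 : 0 < K^-1 by rewrite invr_gt0.
set s := (1 + K^-1) * tau / 2; set k := (1 - K^-1) * tau / 4.
have s0 : 0 < s by rewrite /s; nra.
have k0 : 0 < k by rewrite /k; nra.
have sk : s + 2 * k = tau by rewrite /k /s; field; rewrite gt_eqF.
have sk' : s - 2 * k = tau / K by rewrite /k /s; field; rewrite gt_eqF.
have bounds x := norm_centered_biased_signs b x piB s0 k0.
move: bounds; rewrite /= sk sk'; set f := coded idx _ b => bounds.
have mf : measurable_fun setT f.
  rewrite /f coded_biased_signs; apply: measurable_funD;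
    apply: measurable_funM => //; apply: measurable_signs => //.
  exact: (measurable_union_of idxP).
have mc := measurable_center pi mf.
have bounded r : (1 <= r)%E -> f \in Lfun pi r.
  move=> r1; apply: (@Lfun_bounded _ _ _ _ _ _ (`|s| + `|k|)) => // x.
  rewrite /f coded_biased_signs /= (le_trans (ler_normD _ _))//.
  by rewrite (normrM s) (normrM k) !norm_signs !mulr1.
have up r : (1 <= r)%E -> (centered_norm pi r f <= tau%:E)%E.
  by move=> r1; apply: Lnorm_le_bound => // x; case/andP: (bounds x).
have low : ((tau / K)%:E <= centered_norm pi p%:E f)%E.
  apply: Lnorm_ge_bound => // [|x]; last by case/andP: (bounds x).
  by rewrite divr_ge0// ltW.
have le12 : (1 <= 2%:E :> \bar R)%E by rewrite lee_fin ler1n.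
split; split => //; [exact: bounded| |exact: bounded|exact: up].
apply: le_trans (up _ q1) _.
have -> : tau%:E = (K%:E * (tau / K)%:E)%E.
  by rewrite -EFinM mulrCA mulfV ?mulr1// gt_eqF.
by rewrite lee_wpmul2l// lee_fin ltW.
Qed.

End biased_signs.

(** By ln (1 + u) <= u with u = 2 th / (1 - th), where 1 - th > 1/9. *)
Lemma log_odds_le (th : R) : 0 < th < 8 / 9 -> log_odds th <= 18 * th.
Proof.
move=> /andP[th0 th8]; have th1 : 0 < 1 - th by lra.
have -> : log_odds th = ln (1 + 2 * th / (1 - th)).
  by congr ln; field; rewrite gt_eqF.
have u0 : 0 <= 2 * th / (1 - th) by rewrite divr_ge0; lra.
apply: le_trans (le_ln1Dx _) _; first by lra.
by rewrite ler_pdivrMr//; nra.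
Qed.

Lemma ln_odds_ge (delta : R) : 0 < delta < 4^-1 ->
  ln (4 / 3 * delta)^-1 <= ln ((1 - delta) / delta).
Proof.
move=> /andP[d0 d4]; have d34 : 0 < 4 / 3 * delta by lra.
rewrite ler_ln ?posrE ?invr_gt0 ?divr_gt0//; last by lra.
have -> : (4 / 3 * delta)^-1 = 3 / 4 / delta by field; rewrite gt_eqF.
by rewrite ler_pM2r ?invr_gt0//; lra.
Qed.

(** This [l] maximises the difference of the two sides: it becomes the binary relative entropy (1 -
    2 delta) l, which is at least l / 2. *)
Lemma testing_cost (th delta n : R) (l := ln ((1 - delta) / delta)) :
  0 < th < 8 / 9 -> 0 < delta < 4^-1 -> 0 <= n ->
  1 + l - expR (- l) <=
    log_odds th * th * n + (2 * l + (expR l - expR (- l))) * delta ->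
  6^-1 * (2 / 9 / th) ^+ 2 * ln (4 / 3 * delta)^-1 <= n.
Proof.
move=> th08 d04 n0; have lo := log_odds_le th08; have dl := ln_odds_ge d04.
have /andP[d0 d4] := d04; have /andP[th0 _] := th08.
have d1 : 0 < 1 - delta by lra.
have el : expR l = (1 - delta) / delta by rewrite lnK// posrE divr_gt0.
have eNl : expR (- l) = delta / (1 - delta) by rewrite expRN el invf_div.
have -> : 1 + l - expR (- l) = (1 - 2 * delta) * l +
    (2 * l + (expR l - expR (- l))) * delta.
  by rewrite el eNl; field; rewrite !gt_eqF.
rewrite lerD2r; move: dl; rewrite -/l => dl main.
have L0 : 0 < ln (4 / 3 * delta)^-1 by rewrite ln_gt0// invf_gt1; lra.
have {}main : 2^-1 * ln (4 / 3 * delta)^-1 <= 18 * th ^+ 2 * n.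
  apply: (@le_trans _ _ ((1 - 2 * delta) * l)); first by nra.
  apply: le_trans main _; rewrite ler_wpM2r// expr2 mulrA ler_wpM2r//.
  exact: ltW.
have -> : 6^-1 * (2 / 9 / th) ^+ 2 * ln (4 / 3 * delta)^-1 =
    2 / 243 * ln (4 / 3 * delta)^-1 / th ^+ 2 by field; rewrite gt_eqF.
by rewrite ler_pdivrMr ?exprn_gt0//; lra.
Qed.

Lemma cost_wor_testing Q (p K tau eps delta : R) (q : \bar R) :
  1 <= p -> (p%:E < q)%E -> 1 < K -> 0 < tau ->
  0 < eps < 6^-1 * (1 - K^-1) * tau -> 0 < delta < 4^-1 ->
  algorithm_on Q (cone_class pi p%:E q K `&` ball_class pi 2%:E tau) ->
  approximating pi Q eps delta
    (cone_class pi p%:E q K `&` ball_class pi 2%:E tau) ->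
  ((6^-1 * ((1 - K^-1) * tau / 2 / (3 * eps) / 4) `^ (1 + (2 - 1)^-1) *
     ln (4 / 3 * delta)^-1)%:E <=
    cost_wor Q (cone_class pi p%:E q K `&` ball_class pi 2%:E tau))%E.
Proof.
set C := _ `&` _ => p1 pq K1 tau0 /andP[eps0 eps6] d04 alg app.
have /andP[d0 d4] := d04.
have Ki1 : K^-1 < 1 by rewrite invf_lt1// (lt_trans _ K1).
have [B mB piB] := half_set equi.
set k := (1 - K^-1) * tau / 4.
have k0 : 0 < k by rewrite /k; nra.
have epsk : eps < 2 / 3 * k by rewrite /k; lra.
pose F := biased_signs ((1 + K^-1) * tau / 2) k B.
have FC (T : finType) (idx : G -> T) b : partition_index pi idx ->
    C (coded idx F b) /\ INT pi (coded idx F b) = k * (2 * freq R b - 1).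
  by move=> idxP; split; [exact: biased_signs_in_class|exact: INT_biased_signs].
(* Excludes the supremum -oo of an empty class: a one-cell partition already yields a member. *)
have c0 : (0 <= cost_wor Q C)%E.
  have [idx idxP] := equipartition_index equi (T := 'I_1)
    ltac:(by rewrite card_ord).
  apply: le_trans (ereal_sup_ubound _); last first.
    by exists (coded idx F [ffun=> true]) => //; exact: (FC _ _ _ idxP).1.
  by apply: integral_ge0 => w _; exact: enat_ereal_ge0.
case E : (cost_wor Q C) c0 => [n| |]// n0; last by rewrite leey.
have Cn : (cost_wor Q C <= n%:E)%E by rewrite E.
(* Then k th = 4/3 eps exceeds [eps] with room for concentration, and th < 8/9 amounts to eps < 2/3
   k, the assumed upper bound on [eps]. *)
pose th := 4 / 3 * eps / k.
have thE : k * th = 4 / 3 * eps by rewrite /th; field; rewrite gt_eqF.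
have rhoE : (1 - K^-1) * tau / 2 / (3 * eps) / 4 = 2 / 9 / th.
  have -> : (1 - K^-1) * tau = 4 * k by rewrite /k; field; rewrite gt_eqF; lra.
  by rewrite /th; field; rewrite !gt_eqF.
have th0 : 0 < th by rewrite divr_gt0//; lra.
have th8 : th < 8 / 9 by rewrite ltr_pdivrMr//; lra.
rewrite rhoE lee_fin (_ : 1 + (2 - 1)^-1 = 2%:R); last by field.
rewrite powR_mulrn; last by rewrite mulr_ge0 ?invr_ge0 ?(ltW th0).
have l0 : 0 <= ln ((1 - delta) / delta).
  by rewrite ln_ge0// ler_pdivlMr//; lra.
apply: testing_cost => //; first by rewrite th0.
apply: testing_bound FC k0 _ _ l0 (ltW d0) alg app Cn => //.
  by rewrite thE; apply/andP; split; lra.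
by apply/andP; split; lra.
Qed.

End worst_case_bounds.

Theorem corollary3p14 (R : realType) :
  exists c : \bar R -> R -> R,
  forall (d : measure_display) (G : measurableType d) (pi : probability G R),
  equipartitionable pi ->
  forall (p : R) (q : \bar R) (K tau : R),
  1 <= p -> (p%:E < q)%E -> 1 < K -> 0 < tau ->
  [/\ ~ solvable pi (Lclass pi q),
      forall Q : randomized_algorithm R G,
        algorithm_on Q (cone_class pi p%:E q K) ->
        ereal_sup [set ('E_(Prob Q)[(fun w => `|result Q f w - INT pi f|)%R])%E
                  | f in cone_class pi p%:E q K] = +oo%E,
      forall eps delta : R, 0 < eps -> 0 < delta < 1 ->
        (((2 * ln 2)^-1 * K `^ cone_exponent p q * ln delta^-1)%:E
           <= complexity_fix pi eps delta (cone_class pi p%:E q K))%E &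
      0 < c q K /\
      forall eps delta : R,
        0 < eps < 6^-1 * (1 - K^-1) * tau -> 0 < delta < 4^-1 ->
        ((c q K * (tau / eps) `^ (1 + (fine (min2 q) - 1)^-1)
            * ln (4 / 3 * delta)^-1)%:E
           <= complexity_wor pi eps delta
                (cone_class pi p%:E q K `&` ball_class pi (min2 q) tau))%E].
Proof.
exists (@wor_constant R) => d G pi equi p q K tau p1 pq K1 tau0; split.
- by apply: not_solvable_Lclass => //; rewrite (le_trans _ (ltW pq)).
- by move=> Q; exact: infinite_expected_error.
- by move=> eps delta; exact: fix_complexity.
split=> [|eps delta eps_bounds delta_bounds].
  rewrite mulr_gt0 ?powR_gt0// divr_gt0// subr_gt0 invf_lt1//.
  exact: lt_trans K1.
apply: complexity_ge => Q.
rewrite wor_constantE//; last by case/andP: eps_bounds.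
have [q2|q2] := leP q 2%:E.
  have -> : min2 q = q by rewrite /min2 min_l.
  case: q pq q2 => [q| |]// pq q2 alg app.
  exact: cost_wor_spike alg app.
have -> : min2 q = 2%:E by rewrite /min2 min_r// ltW.
by move=> alg app; exact: cost_wor_testing alg app.
Qed.
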